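(* Let $\mathbb{F}$ be an infinite field of characteristic $p\neq 2$, and let $n=3$, $d=2$. Then the set $$\operatorname{tr}(Y_i),\ \sigma_2(Y_i),\ \det(Y_i)\quad(i=1,2),$$ $$\operatorname{tr}(Y_1Y_2),\ \operatorname{tr}(Y_1^2Y_2),\ \operatorname{tr}(Y_1Y_2^2),\ \operatorname{tr}(Y_1^2Y_2^2)$$ is both a minimal (with respect to inclusion) generating set and a minimal (with respect to inclusion) separating set for the algebra $R_+^{O(3)}$ of $O(3)$-invariants of two symmetric $3\times 3$ matrices.
   Context: Let $R_+=\mathbb{F}[x_{ij}(k)\mid 1\le j\le i\le n,\ 1\le k\le d]$, and let $Y_k$ ($1\le k\le d$) be the $n\times n$ symmetric generic matrix with $(i,j)$ entry $x_{ij}(k)$ if $i\ge j$ and $x_{ji}(k)$ if $i<j$. For an $n\times n$ matrix $A$ over a commutative ring, $\sigma_t(A)$ denotes the $t$-th coefficient of the characteristic polynomial, normalized by $\det(\lambda I-A)=\sum_{t=0}^n(-1)^t\sigma_t(A)\lambda^{n-t}$; so $\sigma_1=\operatorname{tr}$, $\sigma_n=\det$. Let $M(n)$ be the space of $n\times n$ matrices over $\mathbb{F}$, $S_+(n)=\{A\in M(n)\mid A^T=A\}$, $O(n)=\{A\in M(n)\mid AA^T=I_n\}$, and $H_+=S_+(n)^{\oplus d}$, on which $O(n)$ acts by $g\cdot(A_1,\ldots,A_d)=(gA_1g^{-1},\ldots,gA_dg^{-1})$. Elements of $R_+$ are regarded as polynomial functions $H_+\to\mathbb{F}$, where $x_{ij}(k)$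 sends $(A_1,\ldots,A_d)$ to the $(i,j)$ entry of $A_k$. The algebra $R_+^{O(n)}=\{f\in R_+\mid f(g\cdot v)=f(v)\ \text{for all } g\in O(n),\ v\in H_+\}$ is (by a known theorem, for $p\ne2$) the $\mathbb{F}$-subalgebra of $R_+$ generated by all $\sigma_t(b)$, where $1\le t\le n$ and $b$ ranges over all monomials in $Y_1,\ldots,Y_d$. A subset $S\subset R_+^{O(n)}$ is generating if it generates $R_+^{O(n)}$ as an $\mathbb{F}$-algebra. It separates $u,v\in H_+$ if there is $f\in S$ with $f(u)\ne f(v)$, and it is called separating if any $u,v\in H_+$ that are separated by $R_+^{O(n)}$ are separated by $S$. A generating (respectively, separating) set is minimal if no proper subset of it is generating (respectively, separating). *)

(* Defs.v *)
From HB Require Import structures.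
From mathcomp Require Import all_boot all_order all_algebra.
From mathcomp Require Import boolp classical_sets functions cardinality.
From mathcomp Require Import mpoly.

Set Implicit Arguments.
Unset Strict Implicit.
Unset Printing Implicit Defensive.

Import GRing.Theory.
Local Open Scope ring_scope.
Local Open Scope classical_set_scope.

(* Index (i, j, k) of the variable x_ij(k); only j <= i occurs. *)
Definition xidx (n d : nat) : finType :=
  {v : 'I_n * 'I_n * 'I_d | (v.1.2 <= v.1.1)%N}.

Definition Rplus (F : fieldType) (n d : nat) := {mpoly F[#|xidx n d|]}.

(* The value 0 for i < j is a dummy: there is no variable x_ij(k) then. *)
Definition xvar (F : fieldType) (n d : nat) (i j : 'I_n) (k : 'I_d) :
    Rplus F n d :=
  if insub (i, j, k) is Some v then 'X_(enum_rank (v : xidx n d)) else 0.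

Definition Ysym (F : fieldType) (n d : nat) (k : 'I_d) : 'M[Rplus F n d]_n :=
  \matrix_(i, j) if (j <= i)%N then xvar F i j k else xvar F j i k.

(* char_poly A = \det ('X%:M - A) = \sum_t (-1)^t sigma_t(A) 'X^(n-t); meant
   for t <= n (natural subtraction truncates). *)
Definition sigma (R : comNzRingType) (n t : nat) (A : 'M[R]_n) : R :=
  (-1) ^+ t * (char_poly A)`_(n - t).

Definition Hplus (F : fieldType) (n d : nat) : set ('I_d -> 'M[F]_n) :=
  [set A | forall k, (A k)^T = A k].

Definition Ogroup (F : fieldType) (n : nat) : set 'M[F]_n :=
  [set g | g *m g^T = 1%:M].

Definition Oact (F : fieldType) (n d : nat) (g : 'M[F]_n)
    (A : 'I_d -> 'M[F]_n) : 'I_d -> 'M[F]_n :=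
  fun k => g *m A k *m invmx g.

Definition polyfun (F : fieldType) (n d : nat) (f : Rplus F n d)
    (A : 'I_d -> 'M[F]_n) : F :=
  f.@[fun m => let: (i, j, k) := val (enum_val m) in A k i j].

Definition RplusO (F : fieldType) (n d : nat) : set (Rplus F n d) :=
  [set f | forall g A, Ogroup g -> Hplus A ->
             polyfun f (Oact g A) = polyfun f A].

Inductive subalg_gen (F : fieldType) (n d : nat) (S : set (Rplus F n d)) :
    Rplus F n d -> Prop :=
| subalg_gen_mem f of S f : subalg_gen S f
| subalg_gen_const (c : F) : subalg_gen S c%:MP
| subalg_gen_add f g of subalg_gen S f & subalg_gen S g : subalg_gen S (f + g)
| subalg_gen_mul f g of subalg_gen S f & subalg_gen S g : subalg_gen S (f * g).

Definition generating (F : fieldType) (n d : nat) (S : set (Rplus F n d)) :=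
  S `<=` @RplusO F n d /\ subalg_gen S = @RplusO F n d.

Definition separates (F : fieldType) (n d : nat) (S : set (Rplus F n d))
    (u v : 'I_d -> 'M[F]_n) :=
  exists2 f, S f & polyfun f u <> polyfun f v.

Definition separating (F : fieldType) (n d : nat) (S : set (Rplus F n d)) :=
  S `<=` @RplusO F n d /\
  forall u v, Hplus u -> Hplus v ->
    separates (@RplusO F n d) u v -> separates S u v.

Definition minimal_for (T : Type) (P : set T -> Prop) (S : set T) :=
  P S /\ forall S', S' `<` S -> ~ P S'.

(* Main.v *)
(* The invariants are restricted to the slice where A = Y_1 is diagonal, whose
   conjugates are dense because char F <> 2. There the sign changes in O(3) and
   the permutations leave invariants which become polynomials in the ten
   generators after multiplication by a power of the discriminant of A.
   Exchanging the two matrices, the same holds with the discriminant of B = Y_2.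
   The generators satisfy a single relation, a cubic in one of them with leading
   coefficient -4; hence the algebra they generate is free over a polynomial
   ring in nine variables in which the two discriminants are coprime, and both
   denominators can be cleared. For minimality, every generator is the only one
   to distinguish some pair of points. *)
Require Import Defs.
From HB Require Import structures.
From mathcomp Require Import all_boot all_order all_algebra.
From mathcomp Require Import boolp classical_sets functions cardinality.
From mathcomp Require Import mpoly.
From mathcomp Require Import ring.

Set Implicit Arguments.
Unset Strict Implicit.
Unset Printing Implicit Defensive.

Import GRing.Theory.
Local Open Scope ring_scope.
Local Open Scope classical_set_scope.

(** * Polynomials over an infinite field *)

(** Over an arbitrary infinite field a symmetric matrix need not be diagonalisable under O(3), so
    density is shown infinitesimally: curves through diag(0, 1, -1), made of rational rotations and
    diagonal matrices, reach every velocity. The eigenvalues 0, 1, -1 stay distinct in every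
    characteristic other than 2. Characteristic 3 shapes a second step: the sign changes may be
    averaged (a factor 4), but S_3 may not, and division by the characteristic polynomial of A
    replaces averaging there. The single relation is used from two sides. In det B it is quadratic
    with leading coefficient disc(A), not a unit; a sign change on the slice moves det B while
    fixing the other nine coordinates, so this side determines the kernel up to powers of disc(A).
    In t = tr(adj A adj B) it is the cubic with unit leading coefficient, and 1, t, t^2 become a
    basis. Comparing degrees in t removes the remaining powers of disc(A). *)

Lemma mpoly_ind_var (n : nat) (F : fieldType) (P : {mpoly F[n]} -> Prop) :
  (forall c, P c%:MP) -> (forall p q, P p -> P q -> P (p + q)) ->
  (forall i p, P p -> P ('X_i * p)) -> forall p, P p.
Proof.
move=> PC PD PX; elim/mpolyind=> [|c m p _ _ Pp]; first by rewrite -mpolyC0.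
apply: PD => //; rewrite -mul_mpolyC mulrC mpolyXE_id.
elim/big_ind: _ (c%:MP) (PC c) => [q Pq|x y IHx IHy q Pq|i _ q Pq].
- by rewrite mul1r.
- by rewrite -mulrA; apply/IHx/IHy.
- elim: (m i) => [|k IHk]; first by rewrite expr0 mul1r.
  by rewrite exprS -mulrA; apply: PX.
Qed.

Lemma mpoly_rmorph_eq (n : nat) (F : fieldType) (S : nzRingType)
    (f g : {rmorphism {mpoly F[n]} -> S}) :
  (forall c, f c%:MP = g c%:MP) -> (forall i, f 'X_i = g 'X_i) -> f =1 g.
Proof.
move=> fgC fgX; apply: mpoly_ind_var => // [p q fgp fgq|i p fgp].
  by rewrite !rmorphD fgp fgq.
by rewrite !rmorphM fgX fgp.
Qed.

Section InfiniteField.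
Variable F : fieldType.
Hypothesis Finf : infinite_set [set: F].

(** The factor [q] allows finitely many parameters to be excluded: [p * q] still has more roots than
    its degree permits. *)
Lemma poly_eq0_infinite (p q : {poly F}) :
  q != 0 -> (forall x, q.[x] != 0 -> p.[x] = 0) -> p = 0.
Proof.
move=> q0 pq0; suff /eqP: p * q = 0 by rewrite mulf_eq0 (negPf q0) orbF => /eqP.
apply: contrapT => /eqP pq_neq0.
have [s _ sz] := infinite_set_fset (size (p * q)) Finf.
suff rt : all (root (p * q)) (finmap.enum_fset s).
  by have := max_poly_roots pq_neq0 rt (finmap.fset_uniq s); rewrite ltnNge sz.
apply/allP=> x _; rewrite rootE hornerM.
by have [->|/pq0->] := eqVneq q.[x] 0; rewrite (mulr0, mul0r).
Qed.

(** An explicit left inverse: widen the coefficients and substitute the last variable. *)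
Lemma muni_inj n : injective (@muni n F).
Proof.
pose g : {rmorphism {poly {mpoly F[n]}} -> {mpoly F[n.+1]}} :=
  horner_eval 'X_ord_max \o map_poly (@mwiden n F).
suff H : g \o @muni n F =1 idfun.
  by move=> p q e; exact: etrans (esym (H p)) (etrans (congr1 g e) (H q)).
apply: mpoly_rmorph_eq => [c|i].
  by rewrite /= muniC map_polyC /horner_eval hornerC /= mwidenC.
rewrite /= /muni mmapX mmap1U; case: splitP => j /= e; last first.
  rewrite map_polyX /horner_eval hornerX; congr 'X__.
  by apply/val_inj; rewrite /= e ord1 addn0.
rewrite map_polyC /horner_eval hornerC /= /mwiden mmapX mmap1U; congr 'X__.
by apply/val_inj; rewrite /= e.
Qed.

Lemma meval_muni n (v : 'I_n.+1 -> F) (p : {mpoly F[n.+1]}) :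
  p.@[v] =
  (map_poly (meval (fun i => v (widen_ord (leqnSn n) i))) (muni p)).[v ord_max].
Proof.
pose w i := v (widen_ord (leqnSn n) i).
pose g : {rmorphism {poly {mpoly F[n]}} -> F} :=
  horner_eval (v ord_max) \o map_poly (meval w).
suff: meval v =1 g \o @muni n F by apply.
apply: mpoly_rmorph_eq => [c|i].
  by rewrite /= muniC map_polyC /horner_eval hornerC /= !mevalC.
rewrite /= mevalXU /muni mmapX mmap1U; case: splitP => j /= e; last first.
  rewrite map_polyX /horner_eval hornerX; congr v.
  by apply/val_inj; rewrite /= e ord1 addn0.
rewrite map_polyC /horner_eval hornerC /= mevalXU; congr v.
by apply/val_inj; rewrite /= e.
Qed.

Lemma mpoly_eq0_infinite n (p : {mpoly F[n]}) : (forall v, p.@[v] = 0) -> p = 0.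
Proof.
elim: n p => [|n IHn] p p0.
  suff [c pE] : exists c, p = c%:MP.
    by have := p0 (fun=> 0); rewrite pE mevalC => ->; rewrite mpolyC0.
  elim/mpoly_ind_var: p {p0} => [c|p q [c ->] [e ->]|[]//]; first by exists c.
  by exists (c + e); rewrite mpolyCD.
apply: (@muni_inj n); rewrite raddf0; apply/polyP=> k; rewrite coef0.
apply: IHn => v; rewrite -coef_map.
suff -> : map_poly (meval v) (muni p) = 0 by rewrite coef0.
apply: (poly_eq0_infinite (oner_neq0 _)) => x _.
pose w (i : 'I_n.+1) := if insub (val i) is Some j then v j else x.
have := p0 w; rewrite meval_muni /w /= insubF ?ltnn // => <-.
by congr _.[_]; apply: eq_map_poly => r; apply: meval_eq => i; rewrite /= valK.
Qed.
End InfiniteField.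

Lemma meval_dhomogZ (R : comNzRingType) n d (p : {mpoly R[n]}) (x : R)
    (w : 'I_n -> R) :
  p \is d.-homog -> p.@[fun i => x * w i] = x ^+ d * p.@[w].
Proof.
move=> /dhomogP hp; rewrite !mevalE mulr_sumr big_seq [RHS]big_seq.
apply: eq_bigr => m /hp /= <-; rewrite mulrCA; congr (_ * _).
rewrite mdegE -prodrXr -big_split /=.
by apply: eq_bigr => i _; rewrite exprMn.
Qed.

(* Expand along the curve: its first-order term turns the lowest homogeneous
   component of h at z0 into that component evaluated at v. *)
Lemma mpoly_eq0_curve (F : fieldType) n (h : {mpoly F[n]}) (z0 : 'I_n -> F) :
    infinite_set [set: F] ->
    (forall v : 'I_n -> F, exists c : 'I_n -> {poly F},
       [/\ forall i, (c i).[0] = z0 i, forall i, (c i)^`().[0] = v i &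
        exists2 q, q != 0 &
          forall s, q.[s] != 0 -> h.@[fun i => (c i).[s]] = 0]) ->
  h = 0.
Proof.
move=> Finf hc; pose h' := h \mPo [tuple 'X_i + (z0 i)%:MP | i < n].
have h'E w : h'.@[w] = h.@[fun i => w i + z0 i].
  rewrite comp_mpoly_meval; apply: meval_eq => i.
  by rewrite tnth_mktuple mevalD mevalXU mevalC.
suff h'0 : h' = 0.
  apply: (mpoly_eq0_infinite Finf) => w.
  rewrite -(meval_eq (v1 := fun i => w i - z0 i + z0 i)) => [|i].
    by rewrite -(h'E (fun i => w i - z0 i)) h'0 meval0.
  by rewrite subrK.
pose G d := pihomog mdeg d h'; pose N := msize h'.
have hG : h' = \sum_(d < N) G d by apply: pihomog_partitionE.
suff G0 d : G d = 0 by rewrite hG big1.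
elim/ltn_ind: d => d lowG.
have [dN|Nd] := ltnP d N; last first.
  rewrite /G pihomogE big_seq_cond big1 // => m /andP[/msize_mdeg_lt].
  by move=> + /eqP md; rewrite -/N md ltnNge Nd.
apply: (mpoly_eq0_infinite Finf) => v; have [c [c0 c1 [q q0 hq]]] := hc v.
have /all_sig[e cE] i : {e | c i = (z0 i)%:P + 'X * e}.
  apply: cid; have /factor_theorem[e] : root (c i - (z0 i)%:P) 0.
    by rewrite rootE hornerD hornerN hornerC c0 subrr.
  rewrite polyC0 subr0 => /eqP; rewrite subr_eq => /eqP ->.
  by exists e; rewrite addrC mulrC.
have e0 i : (e i).[0] = v i.
  by rewrite -c1 cE !derivE !hornerE.
pose E j := mmap (@polyC F) e (G j).
have EE j s : (E j).[s] = (G j).@[fun i => (e i).[s]].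
  rewrite /E /mmap mevalE horner_sum; apply: eq_bigr => m _.
  rewrite hornerM hornerC /mmap1 horner_prod; congr (_ * _).
  by apply: eq_bigr => i _; rewrite horner_exp.
(* This is [h'] along the curve divided by s^d: the components below [d] vanish by induction, and
   the value at 0 is that of [G d] at [v]. *)
pose P := \sum_(j < N | (d <= j)%N) 'X^(j - d) * E j.
suff P0 : P = 0.
  have := congr1 (horner^~ 0) P0; rewrite horner0 horner_sum /=.
  rewrite (bigD1 (Ordinal dN)) //= subnn expr0 mul1r EE big1 ?addr0.
    by move=> <-; apply: meval_eq => i; rewrite e0.
  move=> j /andP[dj jd]; rewrite hornerM hornerXn expr0n subn_eq0.
  suff -> : (j <= d)%N = false by rewrite mul0r.
  apply: contraNF jd => jd; apply/eqP/val_inj/eqP.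
  by rewrite /= eqn_leq jd dj.
apply: (poly_eq0_infinite Finf (q := 'X * q)) => [|s].
  by rewrite mulf_neq0 ?polyX_eq0.
rewrite hornerM hornerX mulf_eq0 negb_or => /andP[s0 /hq hs].
apply: (mulfI (expf_neq0 d s0)); rewrite mulr0 horner_sum mulr_sumr.
rewrite -[RHS]hs -(meval_eq (v1 := fun i => s * (e i).[s] + z0 i)); last first.
  by move=> i; rewrite cE !hornerE addrC.
rewrite -(h'E (fun i => s * (e i).[s])) hG raddf_sum /= [RHS](bigID (fun j :
  'I_N => (d <= j)%N)) /=.
rewrite [X in _ = _ + X]big1 => [|j]; last first.
  by rewrite -ltnNge => /lowG ->; rewrite meval0.
rewrite addr0; apply: eq_bigr => j dj.
rewrite (meval_dhomogZ _ _ (pihomogP mdeg j h')) hornerM hornerXn EE.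
by rewrite mulrA -exprD subnKC.
Qed.

(** * Matrices of size 3 and invariants *)

Definition mat3 (R : comNzRingType) (a b c d e f g h i : R) : 'M[R]_3 :=
  \matrix_(x, y) nth 0 (nth [::] [:: [:: a; b; c]; [:: d; e; f]; [:: g; h;
    i]] x) y.

(* The off-diagonal entries are p = (2,3), q = (1,3), r = (1,2), each opposite
   to the diagonal entry listed in the same position. *)
Definition sym3 (R : comNzRingType) (a b c p q r : R) : 'M[R]_3 :=
  mat3 a r q r b p q p c.

Section Mat3.
Variable R : comNzRingType.
Implicit Types (A B : 'M[R]_3) (a b c d e f g h i p q r : R).

Lemma mat3P A B :
  (forall x y : nat, (x < 3)%N -> (y < 3)%N ->
    A (inord x) (inord y) = B (inord x) (inord y)) -> A = B.
Proof.
by move=> AB; apply/matrixP => x y; have := AB x y; rewrite !inord_val; apply.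
Qed.

Lemma mat3E A :
  A = mat3 (A ord0 ord0) (A ord0 (inord 1)) (A ord0 (inord 2))
           (A (inord 1) ord0) (A (inord 1) (inord 1)) (A (inord 1) (inord 2))
           (A (inord 2) ord0) (A (inord 2) (inord 1)) (A (inord 2) (inord 2)).
Proof.
have o0 : ord0 = inord 0 :> 'I_3 by apply/val_inj; rewrite /= inordK.
apply: mat3P => -[|[|[|//]]] [|[|[|//]]] _ _; by rewrite mxE !inordK // /= ?o0.
Qed.

Lemma mat3D a b c d e f g h i a' b' c' d' e' f' g' h' i' :
  mat3 a b c d e f g h i + mat3 a' b' c' d' e' f' g' h' i' =
  mat3 (a + a') (b + b') (c + c') (d + d') (e + e') (f + f') (g + g') (h + h')
       (i + i').
Proof. by apply: mat3P => -[|[|[|//]]] [|[|[|//]]] _ _;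
  rewrite !mxE !inordK. Qed.

Lemma mat3Z k a b c d e f g h i :
  k *: mat3 a b c d e f g h i =
  mat3 (k * a) (k * b) (k * c) (k * d) (k * e) (k * f) (k * g) (k * h) (k * i).
Proof. by apply: mat3P => -[|[|[|//]]] [|[|[|//]]] _ _;
  rewrite !mxE !inordK. Qed.

Lemma mat3M a b c d e f g h i a' b' c' d' e' f' g' h' i' :
  mat3 a b c d e f g h i *m mat3 a' b' c' d' e' f' g' h' i' =
  mat3 (a * a' + b * d' + c * g') (a * b' + b * e' + c * h') (a * c'
    + b * f' + c * i')
       (d * a' + e * d' + f * g') (d * b' + e * e' + f * h') (d * c'
         + e * f' + f * i')
       (g * a' + h * d' + i * g') (g * b' + h * e' + i * h') (g * c'
         + h * f' + i * i').
Proof.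
apply: mat3P => -[|[|[|//]]] [|[|[|//]]] _ _;
  by rewrite !mxE !big_ord_recl big_ord0 !mxE /= !inordK //= addr0 addrA.
Qed.

Lemma mat3T a b c d e f g h i :
  (mat3 a b c d e f g h i)^T = mat3 a d g b e h c f i.
Proof. by apply: mat3P => -[|[|[|//]]] [|[|[|//]]] _ _;
  rewrite !mxE !inordK. Qed.

Lemma mat3_scalar a : a%:M = mat3 a 0 0 0 a 0 0 0 a.
Proof.
apply: mat3P => -[|[|[|//]]] [|[|[|//]]] _ _;
  rewrite !mxE -val_eqE /= !inordK //.
Qed.

Lemma mxtrace_mat3 a b c d e f g h i : \tr (mat3 a b c d e f g h i) = a + e + i.
Proof. by rewrite /mxtrace !big_ord_recl big_ord0 !mxE /= addr0 addrA. Qed.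

Lemma det_mat3 a b c d e f g h i :
  \det (mat3 a b c d e f g h i) =
  a * (e * i - f * h) - b * (d * i - f * g) + c * (d * h - e * g).
Proof.
rewrite (expand_det_row _ ord0) !big_ord_recl big_ord0 /cofactor.
rewrite !(expand_det_row _ ord0) !big_ord_recl !big_ord0 /cofactor !det_mx11.
rewrite !mxE /= /bump /=; ring.
Qed.
End Mat3.

Lemma map_mat3 (R S : comNzRingType) (f : R -> S) a b c d e g h i j :
  map_mx f (mat3 a b c d e g h i j) =
  mat3 (f a) (f b) (f c) (f d) (f e) (f g) (f h) (f i) (f j).
Proof. by apply: mat3P => -[|[|[|//]]] [|[|[|//]]] _ _;
  rewrite !mxE !inordK. Qed.

Lemma sigma2_mat3 (R : comNzRingType) (a b c d e f g h i : R) :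
  sigma 2 (mat3 a b c d e f g h i) =
  a * e - b * d + (a * i - c * g) + (e * i - f * h).
Proof.
rewrite /sigma sqrrN expr1n mul1r /char_poly /char_poly_mx map_mat3 mat3_scalar.
rewrite -scaleN1r mat3Z mat3D det_mat3.
set t := a + e + i; set s := (RHS); set k := \det (mat3 a b c d e f g h i).
transitivity (('X^3 - t%:P * 'X^2 + s%:P * 'X - k%:P)`_1).
  by congr (nth 0 (polyseq _) _); rewrite /k det_mat3 /s /t; ring.
by rewrite !(coefD, coefN, coefCM, coefXn, coefX,
  coefC) /= mulr0 mulr1 !oppr0 add0r !addr0 ?add0r.
Qed.

Lemma map_sigma (R S : comNzRingType) (f : {rmorphism R ->
  S}) n t (A : 'M[R]_n) :
  sigma t (map_mx f A) = f (sigma t A).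
Proof. by rewrite /sigma -map_char_poly coef_map rmorphM rmorphXn rmorphN1. Qed.

Lemma mxtrace_sqr3 (R : comNzRingType) (A : 'M[R]_3) :
  \tr (A *m A) = \tr A ^+ 2 - 2 * sigma 2 A.
Proof. by rewrite [A]mat3E mat3M !mxtrace_mat3 sigma2_mat3; ring. Qed.

Section Invariants.
Variables (F : fieldType) (n d : nat).
Implicit Types (f g : Rplus F n d) (A V : 'I_d -> 'M[F]_n).

(** Polymorphic in [T] because it also serves for curves, with polynomial entries, and for the
    generic matrices themselves in [swapR]. *)
Definition pt (T : Type) (A : 'I_d -> 'M[T]_n) (m : 'I_#|xidx n d|) : T :=
  let: (i, j, k) := val (enum_val m) in A k i j.

Lemma polyfunE f A : polyfun f A = meval (pt A) f.
Proof. by []. Qed.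

Lemma map_Ysym A k : Hplus A -> map_mx (meval (pt A)) (Ysym F n k) = A k.
Proof.
move=> HA; apply/matrixP => i j; rewrite !mxE.
have xvarE (x y : 'I_n) : (y <= x)%N -> meval (pt A) (xvar F x y k) = A k x y.
  by move=> yx; rewrite /xvar insubT mevalXU /pt enum_rankK.
case: leqP => [|/ltnW] ij; rewrite xvarE //.
by rewrite -[in LHS]HA mxE.
Qed.

Lemma pt_map_Ysym (v : 'I_#|xidx n d| -> F) :
  pt (fun k => map_mx (meval v) (Ysym F n k)) =1 v.
Proof.
move=> m; rewrite /pt; case e: (val (enum_val m)) => [[i j] k].
have ij : (j <= i)%N by have := valP (enum_val m); rewrite e.
rewrite !mxE ij /xvar insubT mevalXU; congr v.
apply: enum_val_inj; rewrite enum_rankK; apply/val_inj; exact/esym.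
Qed.

Lemma Hplus_map_Ysym (v : 'I_#|xidx n d| -> F) :
  Hplus (fun k => map_mx (meval v) (Ysym F n k)).
Proof.
move=> k; apply/matrixP => i j; rewrite !mxE.
by case: ltngtP => // /val_inj ->.
Qed.

(** Every assignment of values to the variables comes from a symmetric tuple, but only up to
    pointwise equality, whence the first premise. *)
Lemma Hplus_ext (P : ('I_#|xidx n d| -> F) -> Prop) :
  (forall v w, v =1 w -> P v -> P w) -> (forall A, Hplus A -> P (pt A)) ->
  forall v, P v.
Proof.
move=> Pext PA v; apply: Pext (pt_map_Ysym v) _.
exact/PA/Hplus_map_Ysym.
Qed.

Lemma polyfun_eq0 f : infinite_set [set: F] ->
  (forall A, Hplus A -> polyfun f A = 0) -> f = 0.
Proof.
move=> Finf f0; apply: (mpoly_eq0_infinite Finf).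
by apply: Hplus_ext => [v w vw <-|A /f0//]; apply/esym/meval_eq.
Qed.

Lemma Rplus_eq0_curve f A0 : infinite_set [set: F] ->
    (forall V, Hplus V -> exists C : 'I_d -> 'M[{poly F}]_n,
       [/\ forall k i j, (C k i j).[0] = A0 k i j,
           forall k i j, (C k i j)^`().[0] = V k i j &
        exists2 q, q != 0 & forall s, q.[s] != 0 ->
          polyfun f (fun k => map_mx (horner_eval s) (C k)) = 0]) ->
  f = 0.
Proof.
move=> Finf hf; apply: (@mpoly_eq0_curve _ _ f (pt A0) Finf).
apply: Hplus_ext => [v w vw [c [c0 c1 cq]]|V /hf[C [C0 C1 [q q0 hq]]]].
  by exists c; split=> // i; rewrite c1.
exists (pt C); split=> [m|m|]; rewrite /pt; try by case: (val _) => [[i j] k].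
exists q => // s /hq; rewrite polyfunE => h; rewrite -[RHS]h;
  apply: meval_eq => m.
by rewrite /pt; case: (val _) => [[i j] k]; rewrite mxE.
Qed.

Lemma invmx_orthogonal (g : 'M[F]_n) : Ogroup g -> invmx g = g^T.
Proof.
move=> gg; have [ug _] := mulmx1_unit gg.
by rewrite -[RHS](mulKmx ug) gg mulmx1.
Qed.

Lemma Oact_Hplus (g : 'M[F]_n) A : Ogroup g -> Hplus A -> Hplus (Oact g A).
Proof.
move=> gO HA k; rewrite /Oact invmx_orthogonal //.
by rewrite !trmx_mul trmxK HA mulmxA.
Qed.

Lemma RplusOC c : @RplusO F n d c%:MP.
Proof. by move=> g A _ _; rewrite !polyfunE !mevalC. Qed.

Lemma RplusOD f g : RplusO f -> RplusO g -> RplusO (f + g).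
Proof. by move=> hf hg x A xO HA;
  rewrite !polyfunE !mevalD -!polyfunE hf ?hg. Qed.

Lemma RplusOM f g : RplusO f -> RplusO g -> RplusO (f * g).
Proof. by move=> hf hg x A xO HA;
  rewrite !polyfunE !mevalM -!polyfunE hf ?hg. Qed.

Lemma subalg_gen_RplusO (S : set (Rplus F n d)) :
  S `<=` @RplusO F n d -> subalg_gen S `<=` @RplusO F n d.
Proof.
move=> SO f; elim=> [g /SO//|c|g h _ + _|g h _ + _].
- exact: RplusOC.
- exact: RplusOD.
- exact: RplusOM.
Qed.

Lemma subalg_gen_comp (S : set (Rplus F n d)) m (t : m.-tuple (Rplus F n d))
    (Q : {mpoly F[m]}) :
  (forall i, subalg_gen S (tnth t i)) -> subalg_gen S (Q \mPo t).
Proof.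
move=> St; elim/mpoly_ind_var: Q => [c|P Q SP SQ|i P SP].
- by rewrite comp_mpolyC; apply: subalg_gen_const.
- by rewrite comp_mpolyD; apply: subalg_gen_add.
- rewrite rmorphM /=; apply: subalg_gen_mul => //.
  by rewrite comp_mpolyXU -tnth_nth.
Qed.

Lemma polyfun_comp m (t : m.-tuple (Rplus F n d)) (Q : {mpoly F[m]}) A :
  polyfun (Q \mPo t) A = Q.@[fun i => polyfun (tnth t i) A].
Proof. exact: comp_mpoly_meval. Qed.

Lemma generating_separating (S : set (Rplus F n d)) :
  generating S -> separating S.
Proof.
move=> [SO SE]; split=> // u v Hu Hv [f fO fuv]; apply: contrapT => nS.
apply: fuv; move: fO; rewrite -SE; elim=> [g Sg|c|g h _ eg _ eh|g h _ eg _ eh].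
- by apply: contrapT => guv; apply: nS; exists g.
- by rewrite !polyfunE !mevalC.
- by rewrite !polyfunE !mevalD -!polyfunE eg eh.
- by rewrite !polyfunE !mevalM -!polyfunE eg eh.
Qed.
End Invariants.

Section Conjugation.
Variables (F : fieldType) (n : nat) (g : 'M[F]_n).
Hypothesis gU : g \in unitmx.

Lemma conjmxM (A B : 'M[F]_n) :
  (g *m A *m invmx g) *m (g *m B *m invmx g) = g *m (A *m B) *m invmx g.
Proof. by rewrite !mulmxA mulmxKV. Qed.

Lemma mxtrace_conj (A : 'M[F]_n) : \tr (g *m A *m invmx g) = \tr A.
Proof. by rewrite mxtrace_mulC mulKmx. Qed.

Lemma det_conj (A : 'M[F]_n) : \det (g *m A *m invmx g) = \det A.
Proof. by rewrite !det_mulmx mulrAC -det_mulmx mulmxV // det1 mul1r. Qed.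
End Conjugation.

(** By Newton's identity [2 * sigma 2 A] is a combination of traces, and 2 is cancelled. *)
Lemma sigma2_conj (F : fieldType) (g A : 'M[F]_3) :
  (2 : F) != 0 -> g \in unitmx -> sigma 2 (g *m A *m invmx g) = sigma 2 A.
Proof.
move=> n2 gU; apply: (mulfI n2); apply: oppr_inj.
apply: (addrI (\tr A ^+ 2)); rewrite -mxtrace_sqr3.
by rewrite -{1}(mxtrace_conj gU A) -mxtrace_sqr3 conjmxM // mxtrace_conj.
Qed.

(** * The ten generators and their triangular change of coordinates *)

Definition gens (R : comNzRingType) (A B : 'M[R]_3) : seq R :=
  [:: \tr A; sigma 2 A; \det A; \tr B; sigma 2 B; \det B;
      \tr (A *m B); \tr (A *m A *m B); \tr (A *m B *m B);
      \tr (A *m A *m B *m B)].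

(* With adj denoting the adjugate, the entries are sigma_1(A), sigma_2(A),
   sigma_3(A), then tr (B adj A), tr (AB) - tr A tr B, tr B, then the same three
   expressions in adj B instead of B, and det B; they are written in terms of
   the entries of gens A B. *)
Definition zcoord (R : comNzRingType) (s : seq R) : seq R :=
  [:: s`_0; s`_1; s`_2;
      s`_7 - s`_0 * s`_6 + s`_1 * s`_3; s`_6 - s`_0 * s`_3; s`_3;
      s`_9 - s`_3 * s`_7 - s`_0 * s`_8 + s`_0 * s`_3 * s`_6 - s`_1 * s`_4;
      s`_8 - s`_3 * s`_6; s`_4; s`_5].

Definition zinv (R : comNzRingType) (A B : 'M[R]_3) : seq R :=
  zcoord (gens A B).

Lemma map_gens (R S : comNzRingType) (f : {rmorphism R -> S}) (A B : 'M[R]_3) :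
  gens (map_mx f A) (map_mx f B) = map f (gens A B).
Proof. by rewrite /gens /= -!map_mxM !trace_map_mx !map_sigma !det_map_mx. Qed.

Lemma map_zinv (R S : comNzRingType) (f : {rmorphism R -> S}) (A B : 'M[R]_3) :
  zinv (map_mx f A) (map_mx f B) = map f (zinv A B).
Proof. by rewrite /zinv map_gens /zcoord /= !(rmorphB, rmorphD, rmorphM). Qed.

Lemma zcoord_closed (R : comNzRingType) (P : R -> Prop) (s : seq R) :
    P 0 -> (forall x, P x -> P (- x)) ->
    (forall x y, P x -> P y -> P (x + y)) ->
    (forall x y, P x -> P y -> P (x * y)) ->
  (forall j, P s`_j) -> forall i, P (zcoord s)`_i.
Proof.
move=> P0 PN PD PM Ps i.
do 10?[case: i => [|i] /=; first by
  do ?[exact: Ps | apply/PN | apply/PD | apply/PM]].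
by case: i.
Qed.

Section TwoMatrices.
Variable F : fieldType.
Hypothesis two_neq0 : (2 : F) != 0.

Definition i0 : 'I_2 := @Ordinal 2 0 isT.
Definition i1 : 'I_2 := @Ordinal 2 1 isT.

Definition pair2 (T : Type) (A B : T) (k : 'I_2) : T :=
  if val k == 0%N then A else B.

Local Notation Y1 := (Ysym F 3 i0).
Local Notation Y2 := (Ysym F 3 i1).
Local Notation S := [set` gens Y1 Y2].

Lemma pair2E (T : Type) (A : 'I_2 -> T) : A = pair2 (A i0) (A i1).
Proof.
by apply/funext => -[[|[|//]] k]; rewrite /pair2 /=; congr A; apply/val_inj.
Qed.

Lemma Hplus_pair2 (A B : 'M[F]_3) : A^T = A -> B^T = B -> Hplus (pair2 A B).
Proof. by move=> HA HB k; rewrite /pair2; case: ifP. Qed.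

Lemma polyfun_gens A :
  Hplus A -> map (fun f => polyfun f A) (gens Y1 Y2) = gens (A i0) (A i1).
Proof. by move=> HA; rewrite -!(map_Ysym _ HA) map_gens. Qed.

Lemma polyfun_zinv A i :
  Hplus A -> polyfun (zinv Y1 Y2)`_i A = (zinv (A i0) (A i1))`_i.
Proof.
move=> HA; rewrite -!(map_Ysym _ HA) map_zinv.
have [li|gi] := ltnP i 10; first by rewrite (nth_map 0).
by rewrite !nth_default // polyfunE meval0.
Qed.

Lemma gens_RplusO : S `<=` @RplusO F 3 2.
Proof.
suff H (g : 'M[F]_3) (A : 'I_2 -> 'M[F]_3) : Ogroup g -> Hplus A ->
    gens (Oact g A i0) (Oact g A i1) = gens (A i0) (A i1).
  move=> f /= /(nthP 0)[i li <-] g A gO HA.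
  have := H g A gO HA.
  rewrite -polyfun_gens; last exact: Oact_Hplus.
  rewrite -polyfun_gens // => /(congr1 (fun s => s`_i)).
  by rewrite !(nth_map 0).
move=> gg _; have [ug _] := mulmx1_unit gg.
by rewrite /gens /Oact !conjmxM // !mxtrace_conj // !det_conj // !sigma2_conj.
Qed.

Definition zY : 10.-tuple (Rplus F 3 2) := [tuple of zinv Y1 Y2].

Lemma subalg_gen_zY i : subalg_gen S (tnth zY i).
Proof.
rewrite (tnth_nth 0); apply: zcoord_closed => [|f Sf|f g|f g|j].
- by have := subalg_gen_const S 0; rewrite mpolyC0.
- rewrite -mulN1r -mpolyC1 -mpolyCN; apply: subalg_gen_mul => //.
  exact: subalg_gen_const.
- exact: subalg_gen_add.
- exact: subalg_gen_mul.
have [lj|gj] := ltnP j 10; first by apply: subalg_gen_mem; apply: mem_nth.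
by rewrite nth_default // -mpolyC0; apply: subalg_gen_const.
Qed.

Lemma zY_RplusO (Q : {mpoly F[10]}) : RplusO (Q \mPo zY).
Proof.
apply: (subalg_gen_RplusO gens_RplusO); apply: subalg_gen_comp.
exact: subalg_gen_zY.
Qed.

Definition zval (A B : 'M[F]_3) (i : 'I_10) : F := (zinv A B)`_i.

Lemma polyfun_zY (Q : {mpoly F[10]}) A :
  Hplus A -> polyfun (Q \mPo zY) A = Q.@[zval (A i0) (A i1)].
Proof.
move=> HA; rewrite polyfun_comp; apply: meval_eq => i.
by rewrite (tnth_nth 0) polyfun_zinv.
Qed.

End TwoMatrices.

(* The Euler-Rodrigues matrix of the quaternion 1 + ui + vj + wk. *)
Definition rot3 (R : comNzRingType) (u v w : R) : 'M[R]_3 :=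
  mat3 (1 + u ^+ 2 - v ^+ 2 - w ^+ 2) (2 * (u * v - w)) (2 * (u * w + v))
       (2 * (u * v + w)) (1 - u ^+ 2 + v ^+ 2 - w ^+ 2) (2 * (v * w - u))
       (2 * (u * w - v)) (2 * (v * w + u)) (1 - u ^+ 2 - v ^+ 2 + w ^+ 2).

Lemma rot3_tr (R : comNzRingType) (u v w : R) :
  rot3 u v w *m (rot3 u v w)^T = ((1 + u ^+ 2 + v ^+ 2 + w ^+ 2) ^+ 2)%:M.
Proof. by rewrite /rot3 mat3T mat3M mat3_scalar; congr mat3; ring. Qed.

Definition diag3 (R : comNzRingType) (a b c : R) : 'M[R]_3 := sym3 a b c 0 0 0.

Lemma sym3T (R : comNzRingType) (a b c p q r : R) :
  (sym3 a b c p q r)^T = sym3 a b c p q r.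
Proof. exact: mat3T. Qed.

Lemma sym3E (R : comNzRingType) (B : 'M[R]_3) :
  B^T = B -> exists a b c p q r, B = sym3 a b c p q r.
Proof.
move=> HB; have sB i j : B i j = B j i by rewrite -{1}HB mxE.
do 6 eexists; rewrite [LHS]mat3E /sym3.
by rewrite [B (inord 1) ord0]sB [B (inord 2) ord0]sB [B (inord 2) (inord 1)]sB.
Qed.

(** The matrix [e^-1 *: N] is orthogonal, with no square root needed since the scalar is already a
    square. [B] is transported by the inverse conjugation, which is harmless because the slice does
    not restrict it. *)
Lemma polyfun_scaled_conj (F : fieldType) (f : Rplus F 3 2) (N D B : 'M[F]_3)
  e :
  e != 0 -> N *m N^T = (e ^+ 2)%:M -> RplusO f -> D^T = D -> B^T = B ->
  exists2 B', B'^T = B' &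
    polyfun f (pair2 (N *m D *m N^T) B) = polyfun f (pair2 (e ^+ 2 *: D) B').
Proof.
move=> e0 NN fO DT BT; pose g := e^-1 *: N.
have gg : Ogroup g.
  rewrite /Ogroup /= /g linearZ /= -scalemxAl -scalemxAr NN scalerA.
  by rewrite scale_scalar_mx -expr2 -exprMn mulVf ?expr1n.
have [ug _] := mulmx1_unit gg.
have sD : (e ^+ 2 *: D)^T = e ^+ 2 *: D by rewrite linearZ /= DT.
have sB : (g^T *m B *m g)^T = g^T *m B *m g.
  by rewrite !trmx_mul trmxK BT mulmxA.
exists (g^T *m B *m g) => //; rewrite -(fO g _ gg (Hplus_pair2 sD sB)).
congr polyfun; apply/funext => k; rewrite /Oact invmx_orthogonal // /pair2.
case: ifP => _.
  have -> : g^T = e^-1 *: N^T by rewrite /g linearZ.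
  rewrite /g !(=^~ scalemxAl, =^~ scalemxAr) !scalerA.
  by rewrite (_ : _ * _ = 1) ?scale1r //; field.
have g1 : g^T *m g = 1%:M by apply: mulmx1C.
by rewrite !mulmxA gg mul1mx -mulmxA gg mulmx1.
Qed.

(** * Density of the conjugates of the slice *)

Lemma RplusO_eq0_slice (F : fieldType) (f : Rplus F 3 2) :
    infinite_set [set: F] -> (2 : F) != 0 -> RplusO f ->
    (forall a1 a2 a3 (B : 'M[F]_3), B^T = B ->
      polyfun f (pair2 (diag3 a1 a2 a3) B) = 0) ->
  f = 0.
Proof.
move=> Finf n2 fO f0; apply: (Rplus_eq0_curve (A0 :=
  pair2 (diag3 0 1 (-1)) 0) Finf) => V HV.
have [x1 [x2 [x3 [p [q [r VE]]]]]] := sym3E (HV i0).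
(* At parameter 0 the rotation has velocity 2 times the skew matrix of (u, v, w). Its commutator
   with diag(0, 1, -1) has entries 4u', -2v', -2w' at (2,3), (1,3), (1,2), which are to equal [p],
   [q], [r]. *)
pose u := (p / 2 / 2)%:P * 'X; pose v := (- q / 2)%:P * 'X;
  pose w := (- r / 2)%:P * 'X.
pose D := diag3 (x1%:P * 'X) (1 + x2%:P * 'X) (-1 + x3%:P * 'X).
pose C := pair2 (rot3 u v w *m D *m (rot3 u v w)^T) ('X *: map_mx polyC (V i1)).
pose e := 1 + u ^+ 2 + v ^+ 2 + w ^+ 2.
pose jet (M : 'M[{poly F}]_3) := map_mx (fun t : {poly F} => t^`().[0]) M.
have jet0 (M : 'M[{poly F}]_3) i j : map_mx (horner_eval 0) M i j = (M i j).[0].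
  by rewrite mxE.
have jet1 (M : 'M[{poly F}]_3) i j : jet M i j = (M i j)^`().[0].
  by rewrite mxE.
have jetM (M M' : 'M[{poly F}]_3) : jet (M *m M') =
    jet M *m map_mx (horner_eval 0) M' + map_mx (horner_eval 0) M *m jet M'.
  apply/matrixP => i j; rewrite !mxE raddf_sum horner_sum -big_split /=.
  by apply: eq_bigr => k _; rewrite !mxE derivM hornerD !hornerM.
have jetT (M : 'M[{poly F}]_3) : jet M^T = (jet M)^T by rewrite map_trmx.
have N0 : map_mx (horner_eval 0) (rot3 u v w) = 1%:M.
  rewrite /rot3 map_mat3 mat3_scalar /horner_eval.
  by congr mat3; rewrite /u /v /w !hornerE /=; ring.
have D0 : map_mx (horner_eval 0) D = diag3 0 1 (-1).
  rewrite /D /diag3 /sym3 map_mat3 /horner_eval.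
  by congr mat3; rewrite !hornerE /=; ring.
have jetN : jet (rot3 u v w) = mat3 0 r (- q) (- r) 0 (- p / 2) q (p / 2) 0.
  rewrite /jet /rot3 map_mat3.
  by congr mat3; rewrite /u /v /w !derivE !hornerE /=; field.
have jetD : jet D = diag3 x1 x2 x3.
  rewrite /jet /D /diag3 /sym3 map_mat3.
  by congr mat3; rewrite !derivE !hornerE /=; ring.
exists C; split=> [k i j|k i j|].
- rewrite /C /pair2; case: ifP => _; last by rewrite !mxE hornerM hornerX mul0r.
  by rewrite -jet0 !map_mxM -map_trmx N0 D0 trmx1 mul1mx mulmx1.
- rewrite /C [V]pair2E /pair2; case: ifP => _; last first.
    by rewrite !mxE derivM derivX derivC mulr0 addr0 mul1r hornerC.
  rewrite -[LHS]jet1 !(jetM, jetT,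
    map_mxM) -!map_trmx N0 D0 trmx1 !mul1mx !mulmx1 jetN jetD VE.
  rewrite /diag3 /sym3 mat3T !mat3M !mat3D; congr (fun_of_matrix _ i j).
  by congr mat3; field.
exists e => [|s].
  have e1 : e.[0] = 1 by rewrite /e /u /v /w !hornerE /=; ring.
  by apply/eqP => e0; move/eqP: e1; rewrite e0 horner0 eq_sym oner_eq0.
move=> es; pose h := horner_eval s.
have hV : map_mx h ('X *: map_mx polyC (V i1)) = s *: V i1.
  by apply/matrixP => i j; rewrite !mxE /h /horner_eval hornerM hornerX hornerC.
have -> : (fun k => map_mx h (C k)) =
    pair2 (map_mx h (rot3 u v w) *m map_mx h D *m (map_mx h (rot3 u v w))^T)
          (s *: V i1).
  apply/funext => k; rewrite /C /pair2; case: ifP => _ //.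
  by rewrite !map_mxM map_trmx.
have NN : map_mx h (rot3 u v w) *m (map_mx h (rot3 u v w))^T = (e.[s] ^+ 2)%:M.
  rewrite map_trmx -map_mxM rot3_tr map_scalar_mx.
  by congr scalar_mx; rewrite /h /= /horner_eval horner_exp.
have DT : (map_mx h D)^T = map_mx h D by rewrite map_trmx sym3T.
have VT : (s *: V i1)^T = s *: V i1 by rewrite linearZ /= HV.
have [B' B'T ->] := polyfun_scaled_conj es NN fO DT VT.
by rewrite /D /diag3 /sym3 map_mat3 mat3Z /h /horner_eval horner0 !mulr0 f0.
Qed.

(** * The relation between the generators *)

Section Relation.
Variable R : comNzRingType.
Implicit Types e u v a b m d p q r : R.

Definition disc3 e1 e2 e3 : R :=
  e1 ^+ 2 * e2 ^+ 2 - 4 * e2 ^+ 3 - 4 * e1 ^+ 3 * e3 + 18 * e1 * e2 * e3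
  - 27 * e3 ^+ 2.

(* The product of the values of u2 X^2 + u1 X + u0 at the three roots of
   X^3 - e1 X^2 + e2 X - e3. *)
Definition norm3 e1 e2 e3 u0 u1 u2 : R :=
  u0 ^+ 3 + e1 * u0 ^+ 2 * u1 + (e1 ^+ 2 - 2 * e2) * u0 ^+ 2 * u2
  + e2 * u0 * u1 ^+ 2 + (e1 * e2 - 3 * e3) * u0 * u1 * u2
  + (e2 ^+ 2 - 2 * e1 * e3) * u0 * u2 ^+ 2 + e3 * u1 ^+ 3
  + e1 * e3 * u1 ^+ 2 * u2 + e2 * e3 * u1 * u2 ^+ 2 + e3 ^+ 2 * u2 ^+ 3.

(* With the notation of slice_inv below, this is disc3 * sum_k b_k m_k. *)
Definition pairing3 e1 e2 e3 u0 u1 u2 v0 v1 v2 : R :=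
  (2 * e1 ^+ 2 - 6 * e2) * u0 * v0 + (e1 * e2 - 9 * e3) * (u0 * v1 + u1 * v0)
  + (2 * e2 ^+ 2 - 6 * e1 * e3) * (u0 * v2 + u1 * v1 + u2 * v0)
  + (e1 * e2 ^+ 2 - 4 * e1 ^+ 2 * e3 + 3 * e2 * e3) * (u1 * v2 + u2 * v1)
  + (e1 ^+ 2 * e2 ^+ 2 - 2 * e2 ^+ 3 - 4 * e1 ^+ 3 * e3 + 10 * e1 * e2 * e3
     - 9 * e3 ^+ 2) * u2 * v2.

(* Likewise disc3 * ((sum_k b_k m_k)^2 - 4 sum_(k < l) b_k m_k b_l m_l). *)
Definition quartic3 e1 e2 e3 u0 u1 u2 v0 v1 v2 : R :=
  u0 ^+ 2 * (v1 ^+ 2 - 4 * v0 * v2)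
  + u0 * u2 * (4 * e2 * v0 * v2 - 4 * v0 ^+ 2 - 4 * e1 * v0 * v1
    - 4 * e1 ^+ 2 * v0 * v2 - 2 * e2 * v1 ^+ 2 - 2 * e1 * e2 * v1 * v2
      - 2 * e3 * v1 * v2 - 4 * e1 * e3 * v2 ^+ 2)
  + u1 ^+ 2 * (v0 ^+ 2 + e2 ^+ 2 * v2 ^+ 2 - 2 * e2 * v0 * v2
    - 4 * e3 * v1 * v2 - 4 * e1 * e3 * v2 ^+ 2)
  + u1 * u2 * (2 * e2 ^+ 2 * v1 * v2 + 2 * e1 * e2 ^+ 2 * v2 ^+ 2
    + 2 * e2 * e3 * v2 ^+ 2 - 2 * e2 * v0 * v1 - 2 * e1 * e2 * v0 * v2
      - 2 * e3 * v0 * v2 - 4 * e3 * v1 ^+ 2 - 12 * e1 * e3 * v1 * v2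
        - 8 * e1 ^+ 2 * e3 * v2 ^+ 2)
  + u2 ^+ 2 * (e2 ^+ 2 * v1 ^+ 2 + 2 * e1 * e2 ^+ 2 * v1 * v2
    + 2 * e2 * e3 * v1 * v2 + e1 ^+ 2 * e2 ^+ 2 * v2 ^+ 2
      + 2 * e1 * e2 * e3 * v2 ^+ 2 + e3 ^+ 2 * v2 ^+ 2 - 4 * e3 * v0 * v1
        - 4 * e1 * e3 * v0 * v2 - 4 * e1 * e3 * v1 ^+ 2
          - 8 * e1 ^+ 2 * e3 * v1 * v2 - 4 * e1 ^+ 3 * e3 * v2 ^+ 2)
  - u0 * u1 * (2 * v0 * v1 + 4 * e1 * v0 * v2 + 2 * e2 * v1 * v2
    + 4 * e3 * v2 ^+ 2).

Definition rel_lin e1 e2 e3 u0 u1 u2 v0 v1 v2 : R :=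
  - (4 * norm3 e1 e2 e3 u0 u1 u2) - 2 * pairing3 e1 e2 e3 u0 u1 u2 v0 v1 v2.

Definition rel_cst e1 e2 e3 u0 u1 u2 v0 v1 v2 : R :=
  quartic3 e1 e2 e3 u0 u1 u2 v0 v1 v2 - 4 * norm3 e1 e2 e3 v0 v1 v2.

(* For A = diag(a) and B with diagonal b and off-diagonal entries p, q, r, let
   m be the diagonal of adj B. Then 2pqr is a polynomial in det B, b and m,
     while
   p^2 = b2 b3 - m1 and so on; the relation is disc(A) times
   (2pqr)^2 = 4 p^2 q^2 r^2, rewritten in the invariants. *)
Definition rel e1 e2 e3 u0 u1 u2 v0 v1 v2 d : R :=
  disc3 e1 e2 e3 * d ^+ 2 + rel_lin e1 e2 e3 u0 u1 u2 v0 v1 v2 * d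
  + rel_cst e1 e2 e3 u0 u1 u2 v0 v1 v2.

(** The coefficient of [v0 ^+ 2] in [rel]. *)
Definition rel2 e1 e2 u0 u1 u2 v1 v2 : R :=
  u1 ^+ 2 - 4 * u0 * u2 - 4 * (e1 * v1 + (e1 ^+ 2 - 2 * e2) * v2).

(** Once the two top coefficients are known, the other two follow from the values at [v0 = 0] and
    [v0 = 1], so they need not be expanded. *)
Lemma rel_cubic e1 e2 e3 u0 u1 u2 v0 v1 v2 d :
  let rl t := rel e1 e2 e3 u0 u1 u2 t v1 v2 d in
  let k2 := rel2 e1 e2 u0 u1 u2 v1 v2 in
  rl v0 = - 4 * v0 ^+ 3 + k2 * v0 ^+ 2 + (rl 1 - rl 0 + 4 - k2) * v0 + rl 0.
Proof. by rewrite /= /rel /rel_lin /rel_cst /norm3 /pairing3 /quartic3 /rel2;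
  ring. Qed.

(** Entries 3 to 5 are the coefficients of the sum over k of b_k times the product of X - a_l for l
    <> k; entries 6 to 8 are the same with m_k. Evaluation at a_k thus isolates b_k or m_k, up to
    differences of eigenvalues. *)
Definition slice_inv a1 a2 a3 b1 b2 b3 m1 m2 m3 d : seq R :=
  [:: a1 + a2 + a3; a1 * a2 + a1 * a3 + a2 * a3; a1 * a2 * a3;
      b1 * (a2 * a3) + b2 * (a1 * a3) + b3 * (a1 * a2);
      - (b1 * (a2 + a3) + b2 * (a1 + a3) + b3 * (a1 + a2)); b1 + b2 + b3;
      m1 * (a2 * a3) + m2 * (a1 * a3) + m3 * (a1 * a2);
      - (m1 * (a2 + a3) + m2 * (a1 + a3) + m3 * (a1 + a2)); m1 + m2 + m3; d].

Lemma zinv_slice a1 a2 a3 b1 b2 b3 p q r :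
  zinv (diag3 a1 a2 a3) (sym3 b1 b2 b3 p q r) =
  slice_inv a1 a2 a3 b1 b2 b3 (b2 * b3 - p ^+ 2) (b1 * b3 - q ^+ 2)
    (b1 * b2 - r ^+ 2)
    (b1 * b2 * b3 + 2 * (p * q * r)
     - (b1 * p ^+ 2 + b2 * q ^+ 2 + b3 * r ^+ 2)).
Proof.
rewrite /zinv /gens /diag3 /sym3 !mat3M !mxtrace_mat3 !det_mat3 !sigma2_mat3.
rewrite /zcoord /slice_inv /=; do ?[congr (_ :: _)]; ring.
Qed.

Lemma disc3_roots a1 a2 a3 :
  disc3 (a1 + a2 + a3) (a1 * a2 + a1 * a3 + a2 * a3) (a1 * a2 * a3) =
  ((a1 - a2) * (a1 - a3) * (a2 - a3)) ^+ 2.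
Proof. by rewrite /disc3; ring. Qed.

Lemma norm3_roots a1 a2 a3 u0 u1 u2 :
  norm3 (a1 + a2 + a3) (a1 * a2 + a1 * a3 + a2 * a3) (a1 * a2 * a3) u0 u1 u2 =
  (u2 * a1 ^+ 2 + u1 * a1 + u0) * (u2 * a2 ^+ 2 + u1 * a2 + u0)
  * (u2 * a3 ^+ 2 + u1 * a3 + u0).
Proof. by rewrite /norm3; ring. Qed.

Lemma rel_slice0 a1 a2 a3 b1 b2 b3 m1 m2 m3 d :
  let s := slice_inv a1 a2 a3 b1 b2 b3 m1 m2 m3 d in
  rel s`_0 s`_1 s`_2 s`_3 s`_4 s`_5 s`_6 s`_7 s`_8 s`_9 =
  ((a1 - a2) * (a1 - a3) * (a2 - a3)) ^+ 2 *
  (4 * m1 * m2 * m3 + 4 * d * b1 * b2 * b3 + d ^+ 2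
   - 2 * d * (b1 * m1 + b2 * m2 + b3 * m3)
   + (b1 * m1 + b2 * m2 + b3 * m3) ^+ 2
   - 4 * (b1 * m1 * b2 * m2 + b1 * m1 * b3 * m3 + b2 * m2 * b3 * m3)).
Proof.
by rewrite /= /rel /rel_lin /rel_cst !norm3_roots disc3_roots /pairing3
  /quartic3; ring.
Qed.

Lemma rel_slice a1 a2 a3 b1 b2 b3 p q r :
  let s := zinv (diag3 a1 a2 a3) (sym3 b1 b2 b3 p q r) in
  rel s`_0 s`_1 s`_2 s`_3 s`_4 s`_5 s`_6 s`_7 s`_8 s`_9 = 0.
Proof. by move=> s; rewrite /s zinv_slice rel_slice0; ring. Qed.
End Relation.

Section RelationMorphism.
Variables (R S : comNzRingType) (f : {rmorphism R -> S}).

Lemma disc3_morph e1 e2 e3 : f (disc3 e1 e2 e3) = disc3 (f e1) (f e2) (f e3).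
Proof. by rewrite /disc3; ring. Qed.

Lemma rel_lin_morph e1 e2 e3 u0 u1 u2 v0 v1 v2 :
  f (rel_lin e1 e2 e3 u0 u1 u2 v0 v1 v2) =
  rel_lin (f e1) (f e2) (f e3) (f u0) (f u1) (f u2) (f v0) (f v1) (f v2).
Proof. by rewrite /rel_lin /norm3 /pairing3; ring. Qed.

Lemma rel_cst_morph e1 e2 e3 u0 u1 u2 v0 v1 v2 :
  f (rel_cst e1 e2 e3 u0 u1 u2 v0 v1 v2) =
  rel_cst (f e1) (f e2) (f e3) (f u0) (f u1) (f u2) (f v0) (f v1) (f v2).
Proof. by rewrite /rel_cst /norm3 /quartic3; ring. Qed.

Lemma rel_morph e1 e2 e3 u0 u1 u2 v0 v1 v2 d :
  f (rel e1 e2 e3 u0 u1 u2 v0 v1 v2 d) =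
  rel (f e1) (f e2) (f e3) (f u0) (f u1) (f u2) (f v0) (f v1) (f v2) (f d).
Proof. 
rewrite /rel rmorphD (rmorphD f (_ * _)) rmorphM rmorphXn (rmorphM f (rel_lin
  _ _ _ _ _ _ _ _ _)).
by rewrite disc3_morph rel_lin_morph rel_cst_morph. Qed.

Lemma rel2_morph e1 e2 u0 u1 u2 v1 v2 :
  f (rel2 e1 e2 u0 u1 u2 v1 v2) =
  rel2 (f e1) (f e2) (f u0) (f u1) (f u2) (f v1) (f v2).
Proof. by rewrite /rel2; ring. Qed.
End RelationMorphism.

(** * Polynomials in one distinguished variable *)

Section OneVariable.
Variables (F : fieldType) (n : nat) (i : 'I_n).
Implicit Types p q : {mpoly F[n]}.

(* p seen as a polynomial in the i-th variable, with coefficients in the same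
   ring: the image of 'X_i is the new variable. *)
Definition upoly : {mpoly F[n]} -> {poly {mpoly F[n]}} :=
  mmap (polyC \o @mpolyC n F) (fun j => if j == i then 'X else ('X_j)%:P).

HB.instance Definition _ := GRing.RMorphism.on upoly.

Lemma upolyC c : upoly c%:MP = c%:MP%:P.
Proof. by rewrite /upoly mmapC. Qed.

Lemma upolyX : upoly 'X_i = 'X.
Proof. by rewrite /upoly mmapX mmap1U eqxx. Qed.

Lemma upolyXn j : j != i -> upoly 'X_j = ('X_j)%:P.
Proof. by move=> /negPf ji; rewrite /upoly mmapX mmap1U ji. Qed.

Lemma upolyK p : (upoly p).['X_i] = p.
Proof.
suff: horner_eval 'X_i \o upoly =1 idfun by apply.
apply: mpoly_rmorph_eq => [c|j] /=;
  first by rewrite upolyC /horner_eval hornerC.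
have [->|ji] := eqVneq j i; first by rewrite upolyX /horner_eval hornerX.
by rewrite upolyXn // /horner_eval hornerC.
Qed.

Lemma meval_upoly (z w : 'I_n -> F) p : (forall j, j != i -> z j = w j) ->
  p.@[z] = (map_poly (meval w) (upoly p)).[z i].
Proof.
move=> zw; suff: meval z =1 horner_eval (z i) \o map_poly (meval w) \o upoly.
  by apply.
apply: mpoly_rmorph_eq => [c|j] /=.
  by rewrite upolyC map_polyC /horner_eval hornerC /= !mevalC.
rewrite mevalXU; have [->|ji] := eqVneq j i.
  by rewrite upolyX map_polyX /horner_eval hornerX.
by rewrite upolyXn // map_polyC /horner_eval hornerC /= mevalXU zw.
Qed.

(** Independence of the [i]-th variable, stated as an equation on a ring morphism: closure under any
    polynomial formula is then a matter of rewriting. *)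
Definition free p := upoly p = p%:P.

Lemma freeC c : free c%:MP.
Proof. exact: upolyC. Qed.

Lemma freeX j : j != i -> free 'X_j.
Proof. exact: upolyXn. Qed.

Lemma freeD p q : free p -> free q -> free (p + q).
Proof. by rewrite /free => fp fq; rewrite rmorphD /= fp fq polyCD. Qed.

Lemma freeB p q : free p -> free q -> free (p - q).
Proof. by rewrite /free => fp fq; rewrite rmorphB /= fp fq polyCB. Qed.

Lemma freeN p : free p -> free (- p).
Proof. by rewrite /free => fp; rewrite rmorphN /= fp polyCN. Qed.

Lemma freeM p q : free p -> free q -> free (p * q).
Proof. by rewrite /free => fp fq; rewrite rmorphM /= fp fq polyCM. Qed.

Lemma freeXn p k : free p -> free (p ^+ k).
Proof. by rewrite /free => fp; rewrite rmorphXn /= fp polyC_exp. Qed.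

Lemma free_meval z w p : free p -> (forall j, j != i -> z j = w j) ->
  p.@[z] = p.@[w].
Proof. by move=> fp /(meval_upoly p) ->; rewrite fp map_polyC hornerC. Qed.
End OneVariable.

(** Divide [c] by [M]: [q] times the remainder is a multiple of [M] of smaller degree, hence zero.
    Thus [q] is cancelled without being invertible. *)
Lemma monic_dvd_scaled (R : idomainType) (M p c : {poly R}) (q : R) :
  M \is monic -> q != 0 -> M * p = q%:P * c -> exists a, c = a * M.
Proof.
move=> mM q0 e; have cE := Pdiv.RingMonic.rdivp_eq mM c.
have rlt := Pdiv.Ring.ltn_rmodpN0 c (monic_neq0 mM).
move: cE rlt; set a := Pdiv.Ring.rdivp _ _;
  set r := Pdiv.Ring.rmodp _ _ => cE rlt.
suff r0 : r = 0 by exists a; rewrite cE r0 addr0.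
apply: contrapT => /eqP r0.
have qr : q%:P * r = M * (p - q%:P * a) by rewrite mulrBr e cE; ring.
have : q%:P * r != 0 by rewrite mulf_neq0 ?polyC_eq0.
rewrite qr mulf_eq0 negb_or => /andP[_ s0].
move: rlt; rewrite -(size_scale r q0) -mul_polyC qr size_monicM // -subn1.
by rewrite -addnBA ?size_poly_gt0 // ltnNge leq_addr.
Qed.

(** In the [i]-th variable [q] is a nonzero scalar and [P] is monic, so [P] must divide [c]. *)
Lemma dvd_of_coprime_vars (F : fieldType) n (i : 'I_n) (P p q c : {mpoly
  F[n]}) :
    upoly i P \is monic -> free i q -> q != 0 -> P * p = q * c ->
  exists c', c = c' * P.
Proof.
move=> mP fq q0 e; have [a ca] : exists a, upoly i c = a * upoly i P.
  apply: (monic_dvd_scaled (p := upoly i p) mP q0).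
  by have := congr1 (upoly i) e; rewrite !rmorphM /= fq.
exists a.['X_i]; rewrite -[LHS](upolyK i) ca hornerM.
by congr (_ * _); apply: upolyK.
Qed.

Lemma size_lt_mul (R : idomainType) (M u h : {poly R}) :
  (size h < size M)%N -> h = u * M -> u = 0.
Proof.
move=> hM e; apply: contrapT => /eqP u0; move: hM; rewrite e.
have [->|M0] := eqVneq M 0; first by rewrite mulr0 size_poly0.
by rewrite size_mul // -subn1 addnC -addnBA ?size_poly_gt0 // ltnNge leq_addr.
Qed.

Section FreeFormulas.
Variables (F : fieldType) (n : nat) (i : 'I_n).
Implicit Types e u v d : {mpoly F[n]}.
Local Notation free := (free i).
Let up : {rmorphism {mpoly F[n]} -> {poly {mpoly F[n]}}} := upoly i.

Lemma free_disc3 e1 e2 e3 :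
  free e1 -> free e2 -> free e3 -> free (disc3 e1 e2 e3).
Proof.
rewrite /free => f0 f1 f2.
by rewrite (disc3_morph up) (disc3_morph (@polyC {mpoly F[n]})) /= f0 f1 f2.
Qed.

Lemma free_rel_lin e1 e2 e3 u0 u1 u2 v0 v1 v2 :
    free e1 -> free e2 -> free e3 -> free u0 -> free u1 -> free u2 ->
    free v0 -> free v1 -> free v2 ->
  free (rel_lin e1 e2 e3 u0 u1 u2 v0 v1 v2).
Proof.
rewrite /free => f0 f1 f2 f3 f4 f5 f6 f7 f8.
by rewrite (rel_lin_morph up) (rel_lin_morph (@polyC {mpoly F[n]})) /= f0 f1
  f2 f3 f4 f5 f6 f7 f8.
Qed.

Lemma free_rel_cst e1 e2 e3 u0 u1 u2 v0 v1 v2 :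
    free e1 -> free e2 -> free e3 -> free u0 -> free u1 -> free u2 ->
    free v0 -> free v1 -> free v2 ->
  free (rel_cst e1 e2 e3 u0 u1 u2 v0 v1 v2).
Proof.
rewrite /free => f0 f1 f2 f3 f4 f5 f6 f7 f8.
by rewrite (rel_cst_morph up) (rel_cst_morph (@polyC {mpoly F[n]})) /= f0 f1
  f2 f3 f4 f5 f6 f7 f8.
Qed.

Lemma free_rel e1 e2 e3 u0 u1 u2 v0 v1 v2 d :
    free e1 -> free e2 -> free e3 -> free u0 -> free u1 -> free u2 ->
    free v0 -> free v1 -> free v2 -> free d ->
  free (rel e1 e2 e3 u0 u1 u2 v0 v1 v2 d).
Proof.
rewrite /free => f0 f1 f2 f3 f4 f5 f6 f7 f8 f9.
by rewrite (rel_morph up) (rel_morph (@polyC {mpoly F[n]})) /= f0 f1 f2 f3 f4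
  f5 f6 f7 f8 f9.
Qed.

Lemma free_rel2 e1 e2 u0 u1 u2 v1 v2 :
    free e1 -> free e2 -> free u0 -> free u1 -> free u2 ->
    free v1 -> free v2 ->
  free (rel2 e1 e2 u0 u1 u2 v1 v2).
Proof.
rewrite /free => f0 f1 f2 f3 f4 f5 f6.
by rewrite (rel2_morph up) (rel2_morph (@polyC {mpoly F[n]})) /= f0 f1 f2 f3
  f4 f5 f6.
Qed.
End FreeFormulas.

(** * Division by the relation and the kernel of the coordinate map *)

Section Kernel.
Variable F : fieldType.
Hypothesis two_neq0 : (2 : F) != 0.

Local Notation Z := {mpoly F[10]}.
Local Notation o k := (@Ordinal 10 k isT).
Local Notation x k := 'X_(o k).

Definition discA : Z := disc3 (x 0) (x 1) (x 2).
Definition discB : Z := disc3 (x 5) (x 8) (x 9).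
Definition relZ : Z :=
  rel (x 0) (x 1) (x 2) (x 3) (x 4) (x 5) (x 6) (x 7) (x 8) (x 9).

Lemma quarter : exists q : Z, free (o 6) q /\ 4 * q = 1.
Proof.
exists (2^-1 ^+ 2)%:MP; split; first exact: freeC.
rewrite -(mpolyC_nat 10 F 4) -mpolyCM -mpolyC1; congr mpolyC.
by field.
Qed.

Lemma relZ_cubic : exists k : Z * Z * Z,
  [/\ free (o 6) k.1.1, free (o 6) k.1.2, free (o 6) k.2 &
      relZ = - 4 * x 6 ^+ 3 + k.2 * x 6 ^+ 2 + k.1.2 * x 6 + k.1.1].
Proof.
pose rl t : Z := rel (x 0) (x 1) (x 2) (x 3) (x 4) (x 5) t (x 7) (x 8) (x 9).
pose k2 : Z := rel2 (x 0) (x 1) (x 3) (x 4) (x 5) (x 7) (x 8).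
have fx j : j != o 6 -> free (o 6) 'X_j by exact: freeX.
have f0 : free (o 6) (0 : Z) by rewrite -mpolyC0; apply: freeC.
have f1 : free (o 6) (1 : Z) by rewrite -mpolyC1; apply: freeC.
have f4 : free (o 6) (4 : Z) by rewrite -(mpolyC_nat 10 F 4); apply: freeC.
have frl t : free (o 6) t -> free (o 6) (rl t).
  by move=> ft; apply: free_rel => //; apply: fx.
have fk2 : free (o 6) k2 by apply: free_rel2; apply: fx.
exists (rl 0, rl 1 - rl 0 + 4 - k2, k2); split=> //=; first exact: frl.
  by apply: freeB => //; apply: freeD => //; apply: freeB; apply: frl.
exact: rel_cubic.
Qed.

(** The leading coefficient -4 in [x 6] is a unit, so cubes of [x 6] can be eliminated without
    denominators. *)
Lemma mod_relZ (Q : Z) : exists u c0 c1 c2,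
  [/\ free (o 6) c0, free (o 6) c1, free (o 6) c2 &
      Q = u * relZ + (c0 + c1 * x 6 + c2 * x 6 ^+ 2)].
Proof.
have [[[k0 k1] k2] /= [f0 f1 f2 relE]] := relZ_cubic.
have [q [fq q4]] := quarter.
have x3 : x 6 ^+ 3 = q * (k2 * x 6 ^+ 2 + k1 * x 6 + k0 - relZ).
  transitivity (4 * q * x 6 ^+ 3); first by rewrite q4 mul1r.
  by rewrite relE; ring.
have fZ0 : free (o 6) (0 : Z) by rewrite -mpolyC0; apply: freeC.
elim/mpoly_ind_var: Q => [c|P Q|j P].
- exists 0, c%:MP, 0, 0; split=> //; first exact: freeC.
  by rewrite !mul0r !addr0 add0r.
- move=> [u [c0 [c1 [c2 [fc0 fc1 fc2 ->]]]]] [u' [c0' [c1' [c2' [fc0' fc1'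
  fc2' ->]]]]].
  exists (u + u'), (c0 + c0'), (c1 + c1'), (c2 + c2').
  by split; try exact: freeD; ring.
move=> [u [c0 [c1 [c2 [fc0 fc1 fc2 ->]]]]]; have [->|j6] := eqVneq j (o 6).
  exists (x 6 * u - q * c2), (q * c2 * k0), (c0 + q * c2 * k1),
    (c1 + q * c2 * k2).
  have fqc : free (o 6) (q * c2) by apply: freeM.
  split; first by apply: freeM.
  - by apply: freeD => //; apply: freeM.
  - by apply: freeD => //; apply: freeM.
  transitivity (x 6 * u * relZ + c0 * x 6 + c1 * x 6 ^+ 2 + c2 * x 6 ^+ 3).
    by ring.
  by rewrite x3; ring.
have fj := freeX F j6.
exists ('X_j * u), ('X_j * c0), ('X_j * c1), ('X_j * c2).
by split; try exact: freeM; ring.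
Qed.

(** Division by the relation as a quadratic in [x 9], which stands for det B. Its leading
    coefficient [discA] is not a unit, hence the power of [discA]. *)
Lemma pseudo_div_relZ (Q : Z) : exists k u g0 g1,
  [/\ free (o 9) g0, free (o 9) g1 & discA ^+ k * Q = u * relZ + (g0
    + g1 * x 9)].
Proof.
pose l1 : Z := rel_lin (x 0) (x 1) (x 2) (x 3) (x 4) (x 5) (x 6) (x 7) (x 8).
pose l0 : Z := rel_cst (x 0) (x 1) (x 2) (x 3) (x 4) (x 5) (x 6) (x 7) (x 8).
have relE : relZ = discA * x 9 ^+ 2 + l1 * x 9 + l0 by [].
have fx j : j != o 9 -> free (o 9) 'X_j by exact: freeX.
have fD : free (o 9) discA by apply: free_disc3; apply: fx.
have f1 : free (o 9) l1 by apply: free_rel_lin; apply: fx.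
have f0 : free (o 9) l0 by apply: free_rel_cst; apply: fx.
have fZ0 : free (o 9) (0 : Z) by rewrite -mpolyC0; apply: freeC.
move: discA relZ relE fD => D R relE fD; rewrite {}relE.
elim/mpoly_ind_var: Q => [c|P Q|j P].
- exists 0%N, 0, c%:MP, 0; split=> //; first exact: freeC.
  by rewrite expr0 !mul0r mul1r addr0 add0r.
- move=> [k [u [g0 [g1 [fg0 fg1 e]]]]] [k' [u' [g0' [g1' [fg0' fg1' e']]]]].
  have fDk := freeXn k fD; have fDk' := freeXn k' fD.
  exists (k + k')%N, (D ^+ k' * u + D ^+ k * u').
  exists (D ^+ k' * g0 + D ^+ k * g0'), (D ^+ k' * g1 + D ^+ k * g1').
  split; try by apply: freeD; apply: freeM.
  transitivity (D ^+ k' * (D ^+ k * P) + D ^+ k * (D ^+ k' * Q)).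
    by rewrite exprD; ring.
  by rewrite e e'; ring.
move=> [k [u [g0 [g1 [fg0 fg1 e]]]]]; have [->|j9] := eqVneq j (o 9).
  exists k.+1, (D * x 9 * u + g1), (- (g1 * l0)), (D * g0 - g1 * l1).
  split; first by apply: freeN; apply: freeM.
    by apply: freeB; apply: freeM.
  transitivity (D * x 9 * (D ^+ k * P)); first by rewrite exprS; ring.
  by rewrite e; ring.
have fj := freeX F j9.
exists k, ('X_j * u), ('X_j * g0), ('X_j * g1).
split; try exact: freeM.
by rewrite mulrCA e; ring.
Qed.

End Kernel.

Section Dominance.
Variable F : fieldType.
Hypothesis Finf : infinite_set [set: F].
Hypothesis two_neq0 : (2 : F) != 0.

Local Notation Z := {mpoly F[10]}.
Local Notation o k := (@Ordinal 10 k isT).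
Local Notation x k := 'X_(o k).

(* Away from p q r = 0 the slice is submersive onto the first nine coordinates:
   velocities are inverted at a = (0, 1, -1), b = 0, p = q = r = 1. *)
Lemma free_det_eq0 (g : Z) : free (o 9) g ->
    (forall a1 a2 a3 b1 b2 b3 p q r : F, p * q * r != 0 ->
      g.@[zval (diag3 a1 a2 a3) (sym3 b1 b2 b3 p q r)] = 0) ->
  g = 0.
Proof.
move=> fg g0.
pose z0 (i : 'I_10) : F := if i == o 9 then 0 else zval (diag3 0 1 (-1)) (sym3
  0 0 0 1 1 1) i.
apply: (@mpoly_eq0_curve _ _ g z0 Finf) => v; pose w k := v (inord k).
have [lin linE linD] : exists2 lin : F -> F -> {poly F},
    forall c a s, (lin c a).[s] = c + a * s & forall c a, (lin c a)^`() = a%:P.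
  exists (fun c a => c%:P + a%:P * 'X) => [c a s|c a];
    first by rewrite !hornerE.
  by rewrite !derivE; ring.
(* The slopes solve the linear system that equates the first-order terms of the first nine
   coordinates with [w 0], ..., [w 8]; only powers of 2 are inverted. *)
pose a1 := lin 0 (- w 2); pose a2 := lin 1 ((w 0 + w 2 - w 1) / 2).
pose a3 := lin (-1) ((w 0 + w 2 + w 1) / 2).
pose b1 := lin 0 (- w 3); pose b2 := lin 0 ((w 5 + w 3 + w 4) / 2).
pose b3 := lin 0 ((w 5 + w 3 - w 4) / 2).
pose p := lin 1 ((w 6 + w 1) / 2).
pose q := lin 1 (- (w 8 + w 6 + w 1 + w 7 - 2 * w 0) / 2 / 2).
pose r := lin 1 (- (w 8 + w 6 + w 1 - w 7 + 2 * w 0) / 2 / 2).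
(* Coordinate 9 does not occur in [g]; it runs along a line of the required velocity instead of
   following det B. *)
pose c i : {poly F} := if i == o 9 then (v i)%:P * 'X else
  (zinv (diag3 a1 a2 a3) (sym3 b1 b2 b3 p q r))`_i.
have cE s i : i != o 9 -> (c i).[s] =
    zval (diag3 a1.[s] a2.[s] a3.[s])
         (sym3 b1.[s] b2.[s] b3.[s] p.[s] q.[s] r.[s]) i.
  rewrite /c => /negPf ->; rewrite /zval.
  rewrite (_ : diag3 _ _ _ = map_mx (horner_eval s) (diag3 a1 a2 a3));
    last first.
    by rewrite /diag3 /sym3 map_mat3 /horner_eval horner0.
  rewrite (_ : sym3 _ _ _ _ _ _ =
               map_mx (horner_eval s) (sym3 b1 b2 b3 p q r)); last first.
    by rewrite /sym3 map_mat3.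
  by rewrite map_zinv (nth_map 0).
exists c; split=> [i|i|].
- rewrite /z0; case: eqP => [->|/eqP i9]; first by rewrite /c eqxx !hornerE.
  by rewrite cE // /a1 /a2 /a3 /b1 /b2 /b3 /p /q /r !linE !mulr0 !addr0.
- rewrite /c; case: eqP => [->|/eqP i9]; first by rewrite !derivE !hornerE.
  have {i9} : (i < 9)%N by rewrite ltn_neqAle i9 -ltnS ltn_ord.
  have -> : v i = w i by rewrite /w inord_val.
  rewrite !zinv_slice /a1 /a2 /a3 /b1 /b2 /b3 /p /q /r.
  case: i => [[|[|[|[|[|[|[|[|[|//]]]]]]]]] li] _ /=;
    rewrite ?(derivD, derivN, derivM, expr2, linD);
    by rewrite ?(hornerD, hornerN, hornerM, hornerC, linE); field.
exists (p * q * r) => [|s pqr].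
  have pqr0 : (p * q * r).[0] = 1.
    by rewrite !hornerM /p /q /r !linE !mulr0 !addr0 !mulr1.
  by apply/eqP => e; move/eqP: pqr0; rewrite e horner0 eq_sym oner_eq0.
rewrite !hornerM in pqr; rewrite -[RHS](g0 a1.[s] a2.[s] a3.[s] b1.[s] b2.[s]
  b3.[s] _ _ _ pqr).
by apply: (free_meval fg) => i; apply: cE.
Qed.
End Dominance.

Lemma size_poly2_leq (R : nzRingType) (a b c : R) :
  (size (a%:P + b%:P * 'X + c%:P * 'X^2)%R <= 3)%N.
Proof.
apply/leq_sizeP => -[|[|[|j]]] // _.
by rewrite !(coefD, coefCM, coefC, coefX, coefXn) /= !mulr0 !addr0.
Qed.

Lemma size_poly3 (R : idomainType) (a b c d : R) : a != 0 ->
  size (a%:P * 'X^3 + b%:P * 'X^2 + c%:P * 'X + d%:P) = 4.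
Proof.
move=> a0; pose e := d%:P + c%:P * 'X + b%:P * 'X^2.
have -> : a%:P * 'X^3 + b%:P * 'X^2 + c%:P * 'X + d%:P = a%:P * 'X^3 + e.
  by rewrite /e; ring.
have s4 : size (a%:P * 'X^3) = 4 by rewrite mul_polyC size_scale // size_polyXn.
by rewrite size_polyDl s4 // ltnS size_poly2_leq.
Qed.

Section KernelOfInvariants.
Variable F : fieldType.
Hypothesis Finf : infinite_set [set: F].
Hypothesis two_neq0 : (2 : F) != 0.

Local Notation Z := {mpoly F[10]}.
Local Notation o k := (@Ordinal 10 k isT).
Local Notation x k := 'X_(o k).
Local Notation ker Q := (Q \mPo zY F = 0).

Lemma discAE (z : 'I_10 -> F) : (discA F).@[z] = disc3 (z (o 0)) (z (o 1)) (z
  (o 2)).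
Proof. by rewrite /discA (disc3_morph (meval z)) /= !mevalXU. Qed.

Lemma discBE (z : 'I_10 -> F) : (discB F).@[z] = disc3 (z (o 5)) (z (o 8)) (z
  (o 9)).
Proof. by rewrite /discB (disc3_morph (meval z)) /= !mevalXU. Qed.

Lemma zY_eq0 (Q : Z) : ker Q ->
  forall A B : 'M[F]_3, A^T = A -> B^T = B -> Q.@[zval A B] = 0.
Proof.
move=> kQ A B AT BT; have := polyfun_zY Q (Hplus_pair2 AT BT).
by rewrite kQ polyfunE meval0 => <-.
Qed.

Lemma zY_slice_eq0 (Q : Z) :
  (forall a1 a2 a3 b1 b2 b3 p q r : F,
     Q.@[zval (diag3 a1 a2 a3) (sym3 b1 b2 b3 p q r)] = 0) -> ker Q.
Proof.
move=> Q0; apply: RplusO_eq0_slice => // [|a1 a2 a3 B BT].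
  exact: zY_RplusO.
have [b1 [b2 [b3 [p [q [r BE]]]]]] := sym3E BT.
by rewrite polyfun_zY; [rewrite BE Q0 | apply: Hplus_pair2 => //; exact: sym3T].
Qed.

Lemma relZ_ker : ker (relZ F).
Proof.
apply: zY_slice_eq0 => *.
by rewrite /relZ (rel_morph (meval _)) /= !mevalXU /zval /= rel_slice.
Qed.

(** Replacing (p, q, r) by its opposite fixes the first nine coordinates and changes det B by 4pqr.
    Subtracting the two values therefore kills [g1] wherever pqr is nonzero, and then [g0] vanishes
    too. *)
Lemma zY_inj_lin (g0 g1 : Z) :
  free (o 9) g0 -> free (o 9) g1 -> ker (g0 + g1 * x 9) -> g0 = 0 /\ g1 = 0.
Proof.
move=> f0 f1 k01.
have gE := zY_eq0 k01 (sym3T _ _ _ _ _ _) (sym3T _ _ _ _ _ _).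
suff g10 : g1 = 0.
  split=> //; apply: (free_det_eq0 Finf two_neq0 f0) =>
    a1 a2 a3 b1 b2 b3 p q r _.
  by have := gE a1 a2 a3 0 0 0 b1 b2 b3 p q r; rewrite g10 mul0r addr0.
apply: (free_det_eq0 Finf two_neq0 f1) => a1 a2 a3 b1 b2 b3 p q r pqr.
pose z := zval (diag3 a1 a2 a3) (sym3 b1 b2 b3 p q r).
pose z' := zval (diag3 a1 a2 a3) (sym3 b1 b2 b3 (- p) (- q) (- r)).
have zz' j : j != o 9 -> z j = z' j.
  rewrite /z /z' /zval !zinv_slice !sqrrN.
  by case: j => [[|[|[|[|[|[|[|[|[|[|//]]]]]]]]]] lj] //=; rewrite -val_eqE.
have e := gE a1 a2 a3 0 0 0 b1 b2 b3 p q r.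
have e' := gE a1 a2 a3 0 0 0 b1 b2 b3 (- p) (- q) (- r).
rewrite -/(diag3 a1 a2 a3) -/z -/z' !mevalD !mevalM !mevalXU in e e'.
rewrite -(free_meval f0 zz') -(free_meval f1 zz') in e'.
rewrite -/z; have /eqP : g1.@[z] * (z (o 9) - z' (o 9)) = 0.
  transitivity (g0.@[z] + g1.@[z] * z (o 9) - (g0.@[z] + g1.@[z] * z' (o 9))).
    by ring.
  by rewrite e e' subrr.
have -> : z (o 9) - z' (o 9) = 2 * (2 * (p * q * r)).
  by rewrite /z /z' /zval !zinv_slice /=; ring.
by rewrite mulf_eq0 !(mulf_eq0 2) (negPf two_neq0) (negPf pqr) !orbF => /eqP.
Qed.

(** At the coefficients of X^3 - X the discriminant is 4. *)
Lemma discA_neq0 : discA F != 0.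
Proof.
apply/eqP => D0; have := discAE (fun i => if val i == 1%N then -1 else 0).
rewrite D0 meval0 /disc3 /= => e.
have /eqP : (2 : F) ^+ 2 = 0 by rewrite e; ring.
by rewrite expf_eq0 (negPf two_neq0).
Qed.

Lemma discB_neq0 : discB F != 0.
Proof.
apply/eqP => D0; have := discBE (fun i => if val i == 8%N then -1 else 0).
rewrite D0 meval0 /disc3 /= => e.
have /eqP : (2 : F) ^+ 2 = 0 by rewrite e; ring.
by rewrite expf_eq0 (negPf two_neq0).
Qed.

(** The pseudo-remainder is linear in [x 9] and lies in the kernel, hence is zero. *)
Lemma ker_relZ (h : Z) : ker h -> exists k u, discA F ^+ k * h = u * relZ F.
Proof.
move=> kh; have [k [u [g0 [g1 [f0 f1 e]]]]] := pseudo_div_relZ h.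
exists k, u; rewrite e; suff [-> ->] : g0 = 0 /\ g1 = 0.
  by rewrite mul0r !addr0.
apply: zY_inj_lin => //; have := congr1 (comp_mpoly (zY F)) e.
rewrite rmorphM rmorphD rmorphM /= relZ_ker kh !mulr0 add0r => /esym.
exact.
Qed.

(** After multiplication by a power of [discA], which does not involve [x 6], the polynomial is a
    multiple of [relZ]; its degree in [x 6] is below 3, that of [relZ] is 3. *)
Lemma ker_reduced (c0 c1 c2 : Z) :
    free (o 6) c0 -> free (o 6) c1 -> free (o 6) c2 ->
    ker (c0 + c1 * x 6 + c2 * x 6 ^+ 2) -> c0 + c1 * x 6 + c2 * x 6 ^+ 2 = 0.
Proof.
move=> f0 f1 f2 kc; have [k [u e]] := ker_relZ kc.
have [[[k0 k1] k2] /= [fk0 fk1 fk2 relE]] := relZ_cubic F.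
have fD : free (o 6) (discA F ^+ k).
  by apply: freeXn; apply: free_disc3; apply: freeX.
set h := c0 + _ + _ in e *.
have hE : upoly (o 6) h = c0%:P + c1%:P * 'X + c2%:P * 'X^2.
  by rewrite /h !(rmorphD, rmorphXn, rmorphM) /= upolyX f0 f1 f2.
have rE : upoly (o 6) (relZ F) = (-4)%:P * 'X^3 + k2%:P * 'X^2
  + k1%:P * 'X + k0%:P.
  have : free (o 6) (-4 : Z).
    by apply: freeN; rewrite -(mpolyC_nat 10 F 4); apply: freeC.
  rewrite relE; move: (-4 : Z) => m m4.
  by rewrite !(rmorphD, rmorphXn, rmorphM) /= upolyX m4 fk0 fk1 fk2.
have sr : size (upoly (o 6) (relZ F)) = 4.
  rewrite rE size_poly3 // oppr_eq0; apply/eqP => Z4.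
  have [q [_]] := quarter two_neq0; rewrite Z4 mul0r => /esym/eqP.
  by rewrite oner_eq0.
have sh : (size (upoly (o 6) (discA F ^+ k * h)) < 4)%N.
  rewrite rmorphM /= fD hE; apply: (leq_ltn_trans (size_polyMleq _ _)).
  have : (size ((discA F ^+ k)%:P) <= 1)%N by apply: size_polyC_leq1.
  have := size_poly2_leq c0 c1 c2; set h' := c0%:P + _ + _.
  by move=> s3 s1; rewrite ltnS -subn1 leq_subLR; apply: leq_add.
have u0 : upoly (o 6) u = 0.
  have ue := etrans (congr1 (upoly (o 6)) e) (rmorphM (upoly (o 6)) _ _).
  exact: size_lt_mul (leq_trans sh (eq_leq (esym sr))) ue.
have := upolyK (o 6) u; rewrite u0 horner0 => uE.
move/eqP: e; rewrite -uE mul0r mulf_eq0 expf_eq0 (negPf discA_neq0) andbF /=.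
by move=> /eqP.
Qed.
End KernelOfInvariants.

(** * Clearing the discriminants *)

Lemma mul_disc3_morph (R S : comNzRingType) (f : {rmorphism R ->
  S}) m e1 e2 e3 :
  f (m * disc3 e1 e2 e3) = f m * disc3 (f e1) (f e2) (f e3).
Proof. by rewrite rmorphM disc3_morph. Qed.

Section RegularSequence.
Variable F : fieldType.
Hypothesis Finf : infinite_set [set: F].
Hypothesis two_neq0 : (2 : F) != 0.

Local Notation Z := {mpoly F[10]}.
Local Notation o k := (@Ordinal 10 k isT).
Local Notation x k := 'X_(o k).

Lemma upoly_discA_monic (m : Z) : free (o 1) m -> 4 * m = -1 ->
  upoly (o 1) (m * discA F) \is monic.
Proof.
move=> fm m4.
have -> : upoly (o 1) (m * discA F) = 'X^3 +
    ((m * (- 4 * x 0 ^+ 3 * x 2 - 27 * x 2 ^+ 2))%:P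
     + (m * (18 * x 0 * x 2))%:P * 'X + (m * x 0 ^+ 2)%:P * 'X^2).
  transitivity (m%:P * disc3 (x 0)%:P 'X (x 2)%:P : {poly Z}).
    pose up : {rmorphism Z -> {poly Z}} := upoly (o 1).
    have E := mul_disc3_morph up m (x 0) (x 1) (x 2).
    have e0 : up (x 0) = (x 0)%:P by apply: upolyXn.
    have e1 : up (x 1) = 'X by apply: upolyX.
    have e2 : up (x 2) = (x 2)%:P by apply: upolyXn.
    have em : up m = m%:P by exact: fm.
    by rewrite e0 e1 e2 em in E; exact: E.
  have X3 : 'X^3 = - (4 * m)%:P * 'X^3 :> {poly Z}.
    by rewrite m4 polyCN opprK mul1r.
  by rewrite [in RHS]X3 /disc3; ring.
rewrite monicE lead_coefDl ?lead_coefXn // size_polyXn ltnS.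
exact: size_poly2_leq.
Qed.

Lemma discA_zY_neq0 : discA F \mPo zY F != 0.
Proof.
apply/eqP => kD; have f0 : free (o 6) (0 : Z) by rewrite -mpolyC0; apply: freeC.
have fD : free (o 6) (discA F) by apply: free_disc3; apply: freeX.
have := ker_reduced Finf two_neq0 fD f0 f0; rewrite !mul0r !addr0 => /(_ kD).
exact/eqP/discA_neq0.
Qed.

(* The two discriminants involve disjoint sets of variables and discA is monic
   in sigma_2(A) up to the unit -4, so they form a regular sequence on the free
   module of polynomials reduced modulo relZ. *)
Lemma zY_of_disc_multiples (f : Rplus F 3 2) N N' (Q Q' : Z) :
    (discA F ^+ N \mPo zY F) * f = Q \mPo zY F ->
    (discB F ^+ N' \mPo zY F) * f = Q' \mPo zY F ->
  exists P : Z, f = P \mPo zY F.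
Proof.
move=> Qf Q'f.
have [q [_ q4]] := quarter two_neq0; pose m : Z := (- 2^-1 ^+ 2)%:MP.
pose phi : {rmorphism Z -> Rplus F 3 2} := comp_mpoly (zY F).
have [u [c0 [c1 [c2 [f0 f1 f2 QE]]]]] := mod_relZ two_neq0 Q.
have [u' [c0' [c1' [c2' [f0' f1' f2' QE']]]]] := mod_relZ two_neq0 Q'.
set Qr := _ + _ + _ in QE; set Qr' := _ + _ + _ in QE'.
have {u QE}QE : Q \mPo zY F = Qr \mPo zY F.
  rewrite QE (rmorphD phi) (rmorphM phi) -[RHS]add0r; congr (_ + _).
  by rewrite /= relZ_ker // mulr0.
have {u' QE'}QE' : Q' \mPo zY F = Qr' \mPo zY F.
  rewrite QE' (rmorphD phi) (rmorphM phi) -[RHS]add0r; congr (_ + _).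
  by rewrite /= relZ_ker // mulr0.
rewrite {}QE in Qf; rewrite {}QE' in Q'f.
have fA : free (o 6) (discA F ^+ N).
  by apply: freeXn; apply: free_disc3; apply: freeX.
have fB : free (o 6) (discB F ^+ N').
  by apply: freeXn; apply: free_disc3; apply: freeX.
(* Both sides are reduced and represent the same multiple of [f], so they agree as polynomials. *)
have Qrr : discB F ^+ N' * Qr = discA F ^+ N * Qr'.
  move: (discA F ^+ N) (discB F ^+ N') Qf Q'f fA fB => DA DB Qf Q'f fA fB.
  apply/eqP; rewrite -subr_eq0; apply/eqP.
  have dE : DB * Qr - DA * Qr' = (DB * c0 - DA * c0')
    + (DB * c1 - DA * c1') * x 6
      + (DB * c2 - DA * c2') * x 6 ^+ 2 by rewrite /Qr /Qr'; ring.
  rewrite dE; apply: ker_reduced => //; try by apply: freeB; apply: freeM.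
  rewrite -dE rmorphB !rmorphM /= -Qf -Q'f mulrCA subrr //.
have fm : free (o 1) m by apply: freeC.
have m4 : 4 * m = -1.
  rewrite -(mpolyC_nat 10 F 4) -mpolyCM -mpolyC1 -mpolyCN; congr mpolyC.
  by field.
have mP : upoly (o 1) ((m * discA F) ^+ N) \is monic.
  by rewrite rmorphXn; apply: monic_exp; apply: upoly_discA_monic.
have fB1 : free (o 1) (discB F ^+ N').
  by apply: freeXn; apply: free_disc3; apply: freeX.
(* The factor [(- 4) ^+ N] compensates for [m ^+ N], which makes the discriminant monic in [x 1], a
   variable absent from [discB]. *)
have [c' cE] : exists c', Qr = c' * (m * discA F) ^+ N.
  apply: (dvd_of_coprime_vars (p := (- 4) ^+ N * Qr') mP fB1).
    by rewrite expf_neq0 // discB_neq0.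
  rewrite Qrr mulrA -exprMn; congr (_ ^+ N * _).
  rewrite mulrAC (_ : m * -4 = 1) ?mul1r //.
  by transitivity (- (4 * m)); [ring | rewrite m4 opprK].
exists (c' * m ^+ N); apply: (mulfI (expf_neq0 N discA_zY_neq0)).
have -> : (discA F \mPo zY F) ^+ N = discA F ^+ N \mPo zY F.
  exact: esym (rmorphXn phi _ _).
rewrite Qf -[RHS](rmorphM phi); congr (_ \mPo _).
by rewrite cE exprMn mulrA mulrC.
Qed.
End RegularSequence.

(** * Restriction to the slice *)

Section FunctionRings.
Variables (T : Type) (R : comNzRingType).
Implicit Types (C : (T -> R) -> Prop) (f g t : T -> R).

Record fun_ring C : Prop := FunRing {
  fun_ring_ext : forall f g, f =1 g -> C f -> C g;
  fun_ringC : forall c, C (fun=> c);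
  fun_ringD : forall f g, C f -> C g -> C (fun x => f x + g x);
  fun_ringM : forall f g, C f -> C g -> C (fun x => f x * g x) }.

Lemma fun_ringN C f : fun_ring C -> C f -> C (fun x => - f x).
Proof.
move=> CR Cf; apply: (fun_ring_ext CR (f := fun x => -1 * f x)) => [x|].
  by rewrite mulN1r.
by apply: (fun_ringM CR) => //; apply: (fun_ringC CR).
Qed.

Lemma fun_ringX C f n : fun_ring C -> C f -> C (fun x => f x ^+ n).
Proof.
move=> CR Cf; elim: n => [|n IHn]; first exact: (fun_ringC CR).
apply: (fun_ring_ext CR (f := fun x => f x * f x ^+ n)) => [x|].
  by rewrite exprS.
exact: (fun_ringM CR).
Qed.

Definition adjoin C t f := exists f0 f1, [/\ C f0, C f1 & forall x,
  f x = f0 x + f1 x * t x].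

(** The sums f0 + f1 t are closed under products because t^2 already lies in [C]. *)
Lemma fun_ring_adjoin C t :
  fun_ring C -> C (fun x => t x ^+ 2) -> fun_ring (adjoin C t).
Proof.
move=> CR Ct2; split=> [f g fg [f0 [f1 [C0 C1 fE]]]|c|f g|f g].
- by exists f0, f1; split=> // x; rewrite -fg.
- exists (fun=> c), (fun=> 0); split; try exact: (fun_ringC CR).
  by move=> x; rewrite mul0r addr0.
- move=> [f0 [f1 [C0 C1 fE]]] [g0 [g1 [C0' C1' gE]]].
  exists (fun x => f0 x + g0 x), (fun x => f1 x + g1 x).
  by split; try exact: (fun_ringD CR); move=> x; rewrite fE gE; ring.
- move=> [f0 [f1 [C0 C1 fE]]] [g0 [g1 [C0' C1' gE]]].
  exists (fun x => f0 x * g0 x + f1 x * g1 x * t x ^+ 2).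
  exists (fun x => f0 x * g1 x + f1 x * g0 x); split=> [||x].
  + apply: (fun_ringD CR); first exact: (fun_ringM CR).
    by apply: (fun_ringM CR) => //; exact: (fun_ringM CR).
  + by apply: (fun_ringD CR); exact: (fun_ringM CR).
  by rewrite fE gE; ring.
Qed.

Lemma adjoin_base C t f : fun_ring C -> C f -> adjoin C t f.
Proof.
move=> CR Cf; exists f, (fun=> 0); split=> //; first exact: (fun_ringC CR).
by move=> x; rewrite mul0r addr0.
Qed.

Lemma adjoin_gen C t : fun_ring C -> adjoin C t t.
Proof.
move=> CR; exists (fun=> 0), (fun=> 1); split; try exact: (fun_ringC CR).
by move=> x; rewrite mul1r add0r.
Qed.
End FunctionRings.

Section Slice.
Variable F : fieldType.
Hypothesis two_neq0 : (2 : F) != 0.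

Local Notation Z := {mpoly F[10]}.
Local Notation o k := (@Ordinal 10 k isT).
Local Notation X k := 'X_(o k).

(* A slice point is the sequence a1, a2, a3, b1, b2, b3, p, q, r. *)
Definition sliceA (x : seq F) : 'M[F]_3 := diag3 x`_0 x`_1 x`_2.
Definition sliceB (x : seq F) : 'M[F]_3 := sym3 x`_3 x`_4 x`_5 x`_6 x`_7 x`_8.
Definition zslice x := zval (sliceA x) (sliceB x).
Definition slicefun (f : Rplus F 3 2) x :=
  polyfun f (pair2 (sliceA x) (sliceB x)).
Definition dslice (x : seq F) : F :=
  ((x`_0 - x`_1) * (x`_0 - x`_2) * (x`_1 - x`_2)) ^+ 2.

Lemma Hplus_slice x : Hplus (pair2 (sliceA x) (sliceB x)).
Proof. by apply: Hplus_pair2; apply: sym3T. Qed.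

Lemma zslice_disc x : (discA F).@[zslice x] = dslice x.
Proof. by rewrite discAE /zslice /zval zinv_slice /= disc3_roots. Qed.

Definition evslice x : {rmorphism {poly Z} -> F} :=
  horner_eval x`_0 \o map_poly (meval (zslice x)).

Lemma evsliceC x (Q : Z) : evslice x Q%:P = Q.@[zslice x].
Proof. by rewrite /= map_polyC /horner_eval hornerC. Qed.

Lemma evsliceX x : evslice x 'X = x`_0.
Proof. by rewrite /= map_polyX /horner_eval hornerX. Qed.

(* 1 and a2 span F[a1, a2, a3] over the symmetric functions and a1. *)
Definition slice_frac (f : seq F -> F) := exists N (P Q : {poly Z}),
  forall x, dslice x ^+ N * f x = evslice x P + evslice x Q * x`_1.

Lemma slice_frac_ring : fun_ring slice_frac.
Proof.
split=> [f g fg [N [P [Q e]]]|c|f g|f g].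
- by exists N, P, Q => x; rewrite -fg.
- exists 0%N, c%:MP%:P, 0 => x.
  by rewrite rmorph0 evsliceC mevalC expr0 mul1r mul0r addr0.
- move=> [N [P [Q e]]] [N' [P' [Q' e']]].
  pose D := (discA F)%:P; have De x : evslice x D = dslice x by rewrite
    evsliceC zslice_disc.
  exists (N + N')%N, (D ^+ N' * P + D ^+ N * P'),
    (D ^+ N' * Q + D ^+ N * Q') => x.
  transitivity (dslice x ^+ N' * (dslice x ^+ N * f x)
    + dslice x ^+ N * (dslice x ^+ N' * g x)).
    by rewrite exprD; ring.
  rewrite e e'; move: (evslice x) (De x) => ev evD.
  by rewrite !rmorphD !rmorphM !rmorphXn evD; ring.
move=> [N [P [Q e]]] [N' [P' [Q' e']]].
pose E1 : {poly Z} := (X 0)%:P; pose E2 : {poly Z} := (X 1)%:P.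
(* Products are reduced by a2^2 = (E1 - a1) a2 - (E2 - E1 a1 + a1^2), the quadratic equation of a2
   and a3 over a1. *)
exists (N + N')%N, (P * P' - Q * Q' * (E2 - E1 * 'X + 'X * 'X)).
exists (P * Q' + P' * Q + Q * Q' * (E1 - 'X)) => x.
transitivity ((dslice x ^+ N * f x) * (dslice x ^+ N' * g x)).
  by rewrite exprD; ring.
have Ee1 : evslice x E1 = x`_0 + x`_1 + x`_2.
  by rewrite evsliceC mevalXU /zslice /zval zinv_slice.
have Ee2 : evslice x E2 = x`_0 * x`_1 + x`_0 * x`_2 + x`_1 * x`_2.
  by rewrite evsliceC mevalXU /zslice /zval zinv_slice.
clearbody E1 E2; rewrite e e'; move: (evslice x) Ee1 Ee2 (evsliceX x) =>
  ev Ee1 Ee2 EX.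
rewrite !(rmorphB, rmorphD, rmorphM) Ee1 Ee2 EX; ring.
Qed.

Let SC := fun_ringC slice_frac_ring.
Let SD := fun_ringD slice_frac_ring.
Let SM := fun_ringM slice_frac_ring.
Let SX := fun f n => fun_ringX n slice_frac_ring (f := f).
Let SN := fun f => fun_ringN slice_frac_ring (f := f).
Let Sext := fun f g => fun_ring_ext slice_frac_ring (f := f) (g := g).

Lemma slice_frac_div f : slice_frac (fun x => dslice x * f x) -> slice_frac f.
Proof.
by move=> [N [P [Q e]]]; exists N.+1, P, Q => x; rewrite -e exprSr mulrA.
Qed.

Lemma slice_frac_z i : slice_frac (zslice^~ i).
Proof.
exists 0%N, ('X_i)%:P, 0 => x.
by rewrite rmorph0 evsliceC mevalXU expr0 mul1r mul0r addr0.
Qed.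

Lemma slice_frac_a k : (k < 3)%N -> slice_frac (fun x => x`_k).
Proof.
have S0 : slice_frac (fun x => x`_0).
  by exists 0%N, 'X, 0 => x; rewrite rmorph0 evsliceX expr0 mul1r mul0r addr0.
have S1 : slice_frac (fun x => x`_1).
  by exists 0%N, 0, 1 => x; rewrite rmorph0 rmorph1 expr0 !mul1r add0r.
case: k => [|[|[|//]]] _ //.
apply: (Sext (f := fun x => zslice x (o 0) + (- x`_0 + - x`_1))) => [x|].
  by rewrite /zslice /zval zinv_slice /=; ring.
by apply: SD (slice_frac_z _) _; apply: SD; apply: SN.
Qed.

(* b1, b2, b3 are interpolated from their moments by Lagrange's formula. *)
Lemma slice_frac_interp (m : nat -> seq F -> F) (u0 u1 u2 : seq F -> F) :
    slice_frac u0 -> slice_frac u1 -> slice_frac u2 ->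
    (forall x, u0 x = m 0%N x * (x`_1 * x`_2) + m 1%N x * (x`_0 * x`_2)
                      + m 2%N x * (x`_0 * x`_1)) ->
    (forall x, u1 x = - (m 0%N x * (x`_1 + x`_2) + m 1%N x * (x`_0 + x`_2)
                         + m 2%N x * (x`_0 + x`_1))) ->
    (forall x, u2 x = m 0%N x + m 1%N x + m 2%N x) ->
  forall k, (k < 3)%N -> slice_frac (m k).
Proof.
move=> S0 S1 S2 e0 e1 e2 k k3.
pose i := (k.+1 %% 3)%N; pose j := (k.+2 %% 3)%N.
apply: slice_frac_div.
(* The quadratic with coefficients [u2], [u1], [u0] takes at a_k the value m_k (a_k - a_i)(a_k -
   a_j); the remaining factors complete the discriminant. *)
apply: (Sext (f := fun x => (x`_k + - x`_i) * (x`_k + - x`_j) * (x`_i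
  + - x`_j) ^+ 2
    * (u2 x * x`_k ^+ 2 + u1 x * x`_k + u0 x))) => [x|].
  rewrite e0 e1 e2 /dslice /i /j.
  by case: k k3 {i j} => [|[|[|//]]] _ /=; ring.
have Sk := slice_frac_a k3.
have Si : slice_frac (fun x => x`_i) by apply: slice_frac_a; rewrite ltn_mod.
have Sj : slice_frac (fun x => x`_j) by apply: slice_frac_a; rewrite ltn_mod.
have Sij := SD Si (SN Sj); have Sik := SD Sk (SN Si); have Sjk := SD Sk (SN Sj).
by apply: SM (SM (SM Sik Sjk) (SX 2 Sij)) (SD (SD (SM S2 (SX 2 Sk)) (SM S1
  Sk)) S0).
Qed.

Lemma slice_frac_b k : (k < 3)%N -> slice_frac (fun x => x`_(3 + k)).
Proof.
apply: (slice_frac_interp (m := fun k x => x`_(3 + k)) (slice_frac_z (o 3))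
  (slice_frac_z (o 4)) (slice_frac_z (o 5))) => x;
  by rewrite /zslice /zval zinv_slice.
Qed.

(** The same interpolation applied to adj B recovers its diagonal b_i b_j - p_k^2, with b_i and b_j
    already known. *)
Lemma slice_frac_sqr k : (k < 3)%N -> slice_frac (fun x => x`_(6 + k) ^+ 2).
Proof.
pose bb k (x : seq F) := x`_(3 + (k.+1 %% 3)) * x`_(3 + (k.+2 %% 3)).
move=> k3; apply: (Sext (f := fun x =>
  bb k x + - (bb k x - x`_(6 + k) ^+ 2))) => [x|].
  by ring.
have Sbb : slice_frac (bb k) by apply: SM; apply: slice_frac_b; rewrite ltn_mod.
apply: SD => //; apply: SN.
apply: (slice_frac_interp (m := fun k x => bb k x - x`_(6 + k) ^+ 2)
  (slice_frac_z (o 6)) (slice_frac_z (o 7)) (slice_frac_z (o 8))) k3 => x;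
  by rewrite /zslice /zval zinv_slice /bb /=; ring.
Qed.

(** Solve the expansion of det B for 2pqr. *)
Lemma slice_frac_offdiag : slice_frac (fun x => x`_6 * x`_7 * x`_8).
Proof.
have b k : (k < 3)%N -> _ := @slice_frac_b k.
have c k : (k < 3)%N -> _ := @slice_frac_sqr k.
apply: (Sext (f := fun x => 2^-1 * (zslice x (o 9) + (- (x`_3 * x`_4 * x`_5)
   + (x`_3 * x`_6 ^+ 2 + x`_4 * x`_7 ^+ 2 + x`_5 * x`_8 ^+ 2))))) => [x|].
  by rewrite /zslice /zval zinv_slice /=; field.
apply: SM (SC _) (SD (slice_frac_z _) _).
apply: SD; first by apply: SN; apply: SM (SM (b 0%N isT) (b 1%N isT)) (b 2%N
  isT).
apply: SD (SD _ _) _; first exact: SM (b 0%N isT) (c 0%N isT).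
  exact: SM (b 1%N isT) (c 1%N isT).
exact: SM (b 2%N isT) (c 2%N isT).
Qed.

End Slice.

(** * Invariance under sign changes *)

Section SliceInvariance.
Variable F : fieldType.
Hypothesis two_neq0 : (2 : F) != 0.

Local Notation Z := {mpoly F[10]}.
Local Notation o k := (@Ordinal 10 k isT).
Local Notation X k := 'X_(o k).

Lemma slicefun_conj (f : Rplus F 3 2) (g : 'M[F]_3) x y : RplusO f ->
  Ogroup g ->
    g *m sliceA x *m g^T = sliceA y -> g *m sliceB x *m g^T = sliceB y ->
  slicefun f y = slicefun f x.
Proof.
move=> fO gO xyA xyB; rewrite /slicefun -(fO _ _ gO (Hplus_slice x)).
by congr polyfun; apply/funext => k; rewrite /Oact invmx_orthogonal // /pair2;
  case: ifP.
Qed.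

Definition flip (s1 s2 s3 : F) (x : seq F) : seq F :=
  [:: x`_0; x`_1; x`_2; x`_3; x`_4; x`_5; s1 * x`_6; s2 * x`_7; s3 * x`_8].

Lemma slicefun_flip (f : Rplus F 3 2) s1 s2 s3 x : RplusO f ->
    s1 ^+ 2 = 1 -> s2 ^+ 2 = 1 -> s3 ^+ 2 = 1 ->
  slicefun f (flip (s2 * s3) (s1 * s3) (s1 * s2) x) = slicefun f x.
Proof.
move=> fO e1 e2 e3; apply: (slicefun_conj (g := diag3 s1 s2 s3)) => //.
- rewrite /Ogroup /= /diag3 sym3T mat3M mat3_scalar -!expr2 e1 e2 e3.
  by congr mat3; ring.
- rewrite /sliceA /diag3 sym3T !mat3M /flip /=.
  congr mat3; try ring.
  + by rewrite -[RHS]mul1r -e1; ring.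
  + by rewrite -[RHS]mul1r -e2; ring.
  + by rewrite -[RHS]mul1r -e3; ring.
- rewrite /sliceB /diag3 sym3T !mat3M /flip /=.
  congr mat3; try ring.
  + by rewrite -[RHS]mul1r -e1; ring.
  + by rewrite -[RHS]mul1r -e2; ring.
  + by rewrite -[RHS]mul1r -e3; ring.
Qed.

(** Invariance is required under all eight sign patterns, although diagonal matrices in O(3) realise
    only four: coefficients even in each of p, q, r separately are wanted. *)
Definition even_frac (f : seq F -> F) := slice_frac f /\
  forall s1 s2 s3 x, s1 ^+ 2 = 1 -> s2 ^+ 2 = 1 -> s3 ^+ 2 = 1 ->
    f (flip s1 s2 s3 x) = f x.

Lemma even_frac_ring : fun_ring even_frac.
Proof.
have SR := slice_frac_ring F.
split=> [f g fg [Sf If]|c|f g [Sf If] [Sg Ig]|f g [Sf If] [Sg Ig]]; split.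
- exact: (fun_ring_ext SR fg).
- by move=> *; rewrite -!fg If.
- exact: (fun_ringC SR).
- by [].
- exact: (fun_ringD SR).
- by move=> *; rewrite If ?Ig.
- exact: (fun_ringM SR).
- by move=> *; rewrite If ?Ig.
Qed.

Lemma even_frac_coord k : (k < 6)%N -> even_frac (fun x => x`_k).
Proof.
move=> k6; split; last by case: k k6 => [|[|[|[|[|[|//]]]]]].
case: (ltnP k 3) => [|k3]; first exact: slice_frac_a.
by rewrite -(subnKC k3); apply: slice_frac_b; rewrite ltn_subLR.
Qed.

Lemma even_frac_sqr k : (k < 3)%N -> even_frac (fun x => x`_(6 + k) ^+ 2).
Proof.
move=> k3; split; first exact: slice_frac_sqr.
by move=> s1 s2 s3 x e1 e2 e3; case: k k3 => [|[|[|//]]] _ /=;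
  rewrite exprMn ?e1 ?e2 ?e3 mul1r.
Qed.

Local Notation adj1 := (adjoin even_frac (fun x => x`_6)).
Local Notation adj2 := (adjoin adj1 (fun x => x`_7)).
Local Notation adj3 := (adjoin adj2 (fun x => x`_8)).

(** Adjoining p, q, r in turn writes every polynomial on the slice as a combination of the eight
    squarefree monomials in p, q, r with even coefficients. *)
Lemma slicefun_adjoin (f : Rplus F 3 2) : adj3 (slicefun f).
Proof.
have R0 := even_frac_ring.
have R1 : fun_ring adj1 by apply: fun_ring_adjoin R0 (@even_frac_sqr 0 isT).
have R2 : fun_ring adj2.
  by apply: fun_ring_adjoin R1 _; apply: adjoin_base R0 (@even_frac_sqr 1 isT).
have R3 : fun_ring adj3.
  apply: fun_ring_adjoin R2 _; apply: adjoin_base R1 _.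
  exact: adjoin_base R0 (@even_frac_sqr 2 isT).
have adjE g : even_frac g -> adj3 g.
  by move=> Eg; apply: adjoin_base R2 _; apply: adjoin_base R1 _;
    apply: adjoin_base R0 _.
have adjC c : adj3 (fun=> c) by apply: (fun_ringC R3).
have adjk k : (k < 9)%N -> adj3 (fun x => x`_k).
  move=> k9; case: (ltnP k 6) => [k6|k6]; first by apply: adjE;
    apply: even_frac_coord.
  rewrite -(subnKC k6); have : (k - 6 < 3)%N by rewrite ltn_subLR.
  case: (k - 6)%N => [|[|[|//]]] _ /=.
  - by apply: adjoin_base R2 _; apply: adjoin_base R1 _; apply: adjoin_gen R0.
  - by apply: adjoin_base R2 _; apply: adjoin_gen R1.
  - exact: adjoin_gen R2.
have Rext := fun_ring_ext R3.
elim/mpoly_ind_var: f => [c|f g Ef Eg|m f Ef].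
- by apply: Rext (adjC c) => x; rewrite /slicefun polyfunE mevalC.
- by apply: Rext (fun_ringD R3 Ef Eg) => x; rewrite /slicefun !polyfunE mevalD.
apply: (Rext (fun x => pt (pair2 (sliceA x) (sliceB x)) m * slicefun f x)) =>
  [x|].
  by rewrite /slicefun !polyfunE mevalM mevalXU.
apply: (fun_ringM R3) => //; rewrite /pt; case: (val (enum_val m)) => [[i j] k].
rewrite /pair2 /sliceA /sliceB /diag3 /sym3; case: (val k == 0)%N.
  apply: (Rext (fun x => nth 0 (nth [::] [:: [:: x`_0; 0; 0]; [:: 0; x`_1;
    0]; [:: 0; 0; x`_2]] i) j)).
    by move=> x; rewrite mxE.
  by case: i j => [[|[|[|//]]] ?] [[|[|[|//]]] ?] /=;
    exact: adjC || exact: adjk.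
apply: (Rext (fun x => nth 0 (nth [::] [:: [:: x`_3; x`_8; x`_7]; [:: x`_8;
  x`_4; x`_6]; [:: x`_7; x`_6; x`_5]] i) j)).
  by move=> x; rewrite mxE.
by case: i j => [[|[|[|//]]] ?] [[|[|[|//]]] ?] /=; exact: adjk.
Qed.

(** Summing over the four realised sign patterns leaves only the coefficients of 1 and pqr, each
    multiplied by 4. *)
Lemma slicefun_frac (f : Rplus F 3 2) : RplusO f -> slice_frac (slicefun f).
Proof.
move=> fO; have SR := slice_frac_ring F.
have [h0 [h1 [[g0 [g1 [[f0 [f1 [[S0 I0] [S1 I1] gE0]]] [f2 [f3 [[S2 I2] [S3
  I3] gE1]]] hE0]]]
  [g2 [g3 [[f4 [f5 [[S4 I4] [S5 I5] gE2]]] [f6 [f7 [[S6 I6] [S7 I7] gE3]]]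
    hE1]]] fE]]] :=
  slicefun_adjoin f.
apply: (fun_ring_ext SR (f := fun x =>
  f0 x + f7 x * (x`_6 * x`_7 * x`_8))) => [x|]; last first.
  by apply: (fun_ringD SR) S0 _; apply: (fun_ringM SR) S7 _;
    apply: slice_frac_offdiag.
have E y : slicefun f y = f0 y + f1 y * y`_6 + (f2 y + f3 y * y`_6) * y`_7
    + (f4 y + f5 y * y`_6 + (f6 y + f7 y * y`_6) * y`_7) * y`_8.
  by rewrite fE hE0 hE1 gE0 gE1 gE2 gE3.
have n1 : (-1 : F) ^+ 2 = 1 by rewrite sqrrN expr1n.
have p1 : (1 : F) ^+ 2 = 1 by rewrite expr1n.
have e1 := slicefun_flip x fO n1 p1 p1.
have e2 := slicefun_flip x fO p1 n1 p1.
have e3 := slicefun_flip x fO p1 p1 n1.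
rewrite !(mulr1, mul1r) in e1 e2 e3.
rewrite [LHS]E in e1; rewrite [LHS]E in e2; rewrite [LHS]E in e3.
rewrite ?I0 ?I1 ?I2 ?I3 ?I4 ?I5 ?I6 ?I7 //= in e1 e2 e3.
have e := f_equal2 +%R (E x) (f_equal2 +%R (esym e1) (f_equal2 +%R (esym e2)
  (esym e3))).
apply: (mulfI two_neq0); apply: (mulfI two_neq0).
transitivity (slicefun f x + (slicefun f x + (slicefun f x + slicefun f x))).
  by rewrite e; ring.
by ring.
Qed.

End SliceInvariance.

(** * Invariance under permutations of the eigenvalues *)

Section Generation.
Variable F : fieldType.
Hypothesis Finf : infinite_set [set: F].
Hypothesis two_neq0 : (2 : F) != 0.

Local Notation Z := {mpoly F[10]}.
Local Notation o k := (@Ordinal 10 k isT).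
Local Notation X k := 'X_(o k).

Definition swap23 (x : seq F) :=
  [:: x`_0; x`_2; x`_1; x`_3; x`_5; x`_4; x`_6; x`_8; x`_7].
Definition swap12 (x : seq F) :=
  [:: x`_1; x`_0; x`_2; x`_4; x`_3; x`_5; x`_7; x`_6; x`_8].
Definition swap13 (x : seq F) :=
  [:: x`_2; x`_1; x`_0; x`_5; x`_4; x`_3; x`_8; x`_7; x`_6].

Lemma slicefun_swap (f : Rplus F 3 2) x : RplusO f ->
  [/\ slicefun f (swap23 x) = slicefun f x,
    slicefun f (swap12 x) = slicefun f x &
      slicefun f (swap13 x) = slicefun f x].
Proof.
have sw := (@mat3T, @mat3M, @mat3_scalar).
move=> fO; split.
- apply: (slicefun_conj (g := mat3 1 0 0 0 0 1 0 1 0)) => //;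
    rewrite /Ogroup /sliceA /sliceB /diag3 /sym3 /= !sw; by congr mat3; ring.
- apply: (slicefun_conj (g := mat3 0 1 0 1 0 0 0 0 1)) => //;
    rewrite /Ogroup /sliceA /sliceB /diag3 /sym3 /= !sw; by congr mat3; ring.
- apply: (slicefun_conj (g := mat3 0 0 1 0 1 0 1 0 0)) => //;
    rewrite /Ogroup /sliceA /sliceB /diag3 /sym3 /= !sw; by congr mat3; ring.
Qed.

Lemma zslice_swap x :
  [/\ zslice (swap23 x) = zslice x, zslice (swap12 x) = zslice x &
      zslice (swap13 x) = zslice x].
Proof.
rewrite /zslice /zval !zinv_slice /=.
by split; apply/funext => i; congr nth; do ?[congr (_ :: _)]; ring.
Qed.

(* Modulo the characteristic polynomial of A, the numerator is a quadratic
   polynomial in a1; S_3-invariance makes it take the same value at the three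
   eigenvalues. *)
Lemma slice_disc_multiple (f : Rplus F 3 2) : RplusO f ->
  exists N (Q : Z), forall x, dslice x ^+ N * slicefun f x = Q.@[zslice x].
Proof.
move=> fO; have [N [P [Q e]]] := slicefun_frac two_neq0 fO.
pose chi : {poly Z} := 'X^3 + ((- X 2)%:P + (X 1)%:P * 'X + (- X 0)%:P * 'X^2).
have chi_monic : chi \is monic.
  rewrite monicE lead_coefDl ?lead_coefXn // size_polyXn ltnS.
  exact: size_poly2_leq.
pose r := Pdiv.Ring.rmodp P chi.
(* The additional factor [discA] makes both sides vanish at points with a repeated eigenvalue, so
   that only distinct eigenvalues remain to be treated. *)
exists N.+1, (discA F * r`_0) => x.
rewrite mevalM zslice_disc exprS -mulrA.
have [->|D0] := eqVneq (dslice x) 0; first by rewrite !mul0r.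
congr (_ * _); pose pz y : {poly F} := map_poly (meval (zslice y)) P.
have Dswap y : (dslice (swap23 y) = dslice y) * (dslice (swap12 y) = dslice y)
    * (dslice (swap13 y) = dslice y).
  by rewrite /dslice /=; do !split; ring.
(* Exchanging a2 and a3 changes nothing in the equation except the factor a2, so its coefficient is
   zero when a2 and a3 differ. *)
have key y : dslice y != 0 -> dslice y ^+ N * slicefun f y = (pz y).[y`_0].
  move=> Dy; have ey := e y; have ey' := e (swap23 y).
  have [zy _ _] := zslice_swap y; have [fy _ _] := slicefun_swap y fO.
  move: ey'; rewrite Dswap fy ey /evslice /= zy.
  set q := horner_eval _ (map_poly _ Q).
  move/addrI/eqP; rewrite -subr_eq0 -mulrBr mulf_eq0 => /orP[/eqP q0|].
    by rewrite q0 mul0r addr0.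
  move=> /eqP y12; move: Dy; rewrite /dslice (_ : y`_1 - y`_2 = 0) //.
  by rewrite mulr0 expr0n eqxx.
have [_ z12 z13] := zslice_swap x; have [_ f12 f13] := slicefun_swap x fO.
have k1 := key x D0.
have := key (swap12 x); rewrite Dswap f12 /pz z12 -/(pz x) => /(_ D0) /= k2.
have := key (swap13 x); rewrite Dswap f13 /pz z13 -/(pz x) => /(_ D0) /= k3.
set G := dslice x ^+ N * _ in k1 k2 k3 *.
pose rz := map_poly (meval (zslice x)) r.
have chi_root t : t \in [:: x`_0; x`_1;
  x`_2] -> (map_poly (meval (zslice x)) chi).[t] = 0.
  pose ev : {rmorphism {poly Z} -> F} :=
    horner_eval t \o map_poly (meval (zslice x)).
  have evX : ev 'X = t by rewrite /= map_polyX /horner_eval hornerX.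
  have evC R : ev R%:P = R.@[zslice x] by rewrite /= map_polyC /horner_eval
    hornerC.
  move=> ht; rewrite -[LHS]/(ev chi); move: ev evX evC => ev evX evC.
  rewrite /chi !(rmorphD, rmorphXn, rmorphM) evX !evC !mevalN !mevalXU.
  rewrite /zslice /zval zinv_slice /=; move: ht; rewrite !inE.
  by case/or3P => /eqP ->; ring.
have rzE t : t \in [:: x`_0; x`_1; x`_2] -> (pz x).[t] = rz.[t].
  move=> ht; rewrite /pz (Pdiv.RingMonic.rdivp_eq chi_monic P) rmorphD rmorphM.
  by rewrite hornerD hornerM (chi_root t ht) mulr0 add0r.
have rz0 : rz - G%:P = 0.
  apply: contrapT => /eqP nz.
  have rt : all (root (rz - G%:P)) [:: x`_0; x`_1; x`_2].
    apply/allP => t ht; rewrite rootE hornerD hornerN hornerC -rzE //.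
    move: ht; rewrite !inE; case/or3P => /eqP ->;
      rewrite -?k1 -?k2 -?k3 subrr //.
  have ut : uniq [:: x`_0; x`_1; x`_2].
    have : (x`_0 - x`_1) * (x`_0 - x`_2) * (x`_1 - x`_2) != 0.
      by apply: contraNneq D0; rewrite /dslice => ->; rewrite expr0n.
    rewrite !mulf_eq0 !subr_eq0 !negb_or => /andP[/andP[n12 n13] n23].
    by rewrite /= !inE negb_or n12 n13 n23.
  have := max_poly_roots nz rt ut; rewrite ltnNge => /negP; apply.
  apply: leq_trans (size_polyD _ _) _; rewrite geq_max size_polyN.
  apply/andP; split; last by apply: leq_trans (size_polyC_leq1 _) _.
  apply: leq_trans (size_poly _ _) _.
  have sc : size chi = 4.
    by rewrite /chi size_polyDl size_polyXn // ltnS size_poly2_leq.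
  by have := Pdiv.Ring.ltn_rmodpN0 P (monic_neq0 chi_monic); rewrite sc ltnS.
have := congr1 (fun p : {poly F} => p`_0) rz0.
by rewrite coefB coefC eqxx coef0 /rz coef_map => /eqP;
  rewrite subr_eq0 => /eqP.
Qed.

Lemma disc_multiple (f : Rplus F 3 2) : RplusO f ->
  exists N (Q : Z), (discA F ^+ N \mPo zY F) * f = Q \mPo zY F.
Proof.
move=> fO; have [N [Q e]] := slice_disc_multiple fO; exists N, Q.
apply/eqP; rewrite -subr_eq0; apply/eqP.
apply: RplusO_eq0_slice => // [|a1 a2 a3 B BT].
  have zO P := zY_RplusO two_neq0 P.
  rewrite -mulN1r -mpolyC1 -mpolyCN; apply: RplusOD; apply: RplusOM => //.
  exact: RplusOC.
have [b1 [b2 [b3 [p [q [r ->]]]]]] := sym3E BT.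
have := e [:: a1; a2; a3; b1; b2; b3; p; q; r].
rewrite /slicefun -zslice_disc; set A := sliceA _; set B' := sliceB _ => ee.
have HAB : Hplus (pair2 A B') by apply: Hplus_slice.
rewrite polyfunE mevalB mevalM -!polyfunE !polyfun_zY //= (rmorphXn (meval _))
  /=.
by rewrite ee subrr.
Qed.
End Generation.

(** * Exchange of the two matrices *)

Section Generating.
Variable F : fieldType.
Hypothesis Finf : infinite_set [set: F].
Hypothesis two_neq0 : (2 : F) != 0.

Local Notation Z := {mpoly F[10]}.
Local Notation o k := (@Ordinal 10 k isT).
Local Notation x k := 'X_(o k).
Local Notation Y1 := (Ysym F 3 i0).
Local Notation Y2 := (Ysym F 3 i1).

Definition swapR (f : Rplus F 3 2) : Rplus F 3 2 :=
  f \mPo [tuple pt (fun k => Ysym F 3 (rev_ord k)) m | m < #|xidx 3 2|].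

Lemma polyfun_swapR f (A B : 'M[F]_3) : A^T = A -> B^T = B ->
  polyfun (swapR f) (pair2 A B) = polyfun f (pair2 B A).
Proof.
move=> AT BT; have HAB := Hplus_pair2 AT BT.
rewrite polyfun_comp polyfunE; apply: meval_eq => m.
rewrite tnth_mktuple /pt; case: (val (enum_val m)) => [[i j] k].
have := map_Ysym (rev_ord k) HAB => /matrixP/(_ i j);
  rewrite mxE -polyfunE => ->.
by rewrite /pair2; case: k => [[|[|//]] ?].
Qed.

Lemma swapR_RplusO f : RplusO f -> RplusO (swapR f).
Proof.
move=> fO g A gO HA; have HgA := Oact_Hplus gO HA.
have HA' : Hplus (pair2 (A i1) (A i0)) by apply: Hplus_pair2; apply: HA.
rewrite (pair2E (Oact g A)) [in RHS](pair2E A) !polyfun_swapR //.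
rewrite -(fO _ _ gO HA'); congr polyfun; apply/funext => k.
by rewrite /Oact /pair2; case: ifP.
Qed.

Lemma gens_swap (A B : 'M[F]_3) :
  let s := gens A B in
  gens B A = [:: s`_3; s`_4; s`_5; s`_0; s`_1; s`_2; s`_6; s`_8; s`_7; s`_9].
Proof.
rewrite /gens /=; do ?[congr (_ :: _)] => //.
- exact: mxtrace_mulC.
- by rewrite mxtrace_mulC mulmxA.
- by rewrite -mulmxA mxtrace_mulC.
- by rewrite -mulmxA mxtrace_mulC !mulmxA.
Qed.

(** Nearly a permutation: entries 3 and 7 are corrected because [zcoord] subtracts tr A tr (adj B)
    from tr (A adj B) but leaves tr (B adj A) as it is. *)
Definition zswap : 10.-tuple Z :=
  [tuple x 5; x 8; x 9; x 7 + x 0 * x 8; x 4; x 0; x 6; x 3 - x 5 * x 1; x 1;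
    x 2].

Lemma zval_swap (A B : 'M[F]_3) i : zval B A i = (tnth zswap i).@[zval A B].
Proof.
rewrite (tnth_nth 0) /zval /zinv gens_swap; move: (gens A B) => s.
case: i => [[|[|[|[|[|[|[|[|[|[|//]]]]]]]]]] li] /=;
  rewrite ?(mevalB, mevalD, mevalM) ?mevalN ?mevalM !mevalXU /=; ring.
Qed.

Lemma disc_multiple_swap (f : Rplus F 3 2) : RplusO f ->
  exists N (Q : Z), (discB F ^+ N \mPo zY F) * f = Q \mPo zY F.
Proof.
move=> fO; have [N [Q e]] := disc_multiple Finf two_neq0 (swapR_RplusO fO).
exists N, (Q \mPo zswap); apply/eqP; rewrite -subr_eq0; apply/eqP.
apply: polyfun_eq0 => // A HA; rewrite polyfunE mevalB mevalM -!polyfunE.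
rewrite !polyfun_zY //= comp_mpoly_meval.
rewrite -(meval_eq Q (zval_swap _ _)) [in polyfun f A](pair2E A).
have HA' : Hplus (pair2 (A i1) (A i0)) by apply: Hplus_pair2; apply: HA.
have := congr1 (fun h => polyfun h (pair2 (A i1) (A i0))) e.
rewrite polyfunE mevalM -!polyfunE !polyfun_zY // polyfun_swapR; try exact: HA.
rewrite !(rmorphXn (meval _)) /= discAE discBE => <-.
have sw := zval_swap (A i0) (A i1).
by rewrite (sw (o 0)) (sw (o 1)) (sw (o 2)) !(tnth_nth 0) !mevalXU subrr.
Qed.

Lemma gens_generating : generating [set` gens Y1 Y2].
Proof.
have SO := gens_RplusO two_neq0; split=> //.
apply/seteqP; split; first exact: subalg_gen_RplusO.
move=> f fO; have [N [Q e]] := disc_multiple Finf two_neq0 fO.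
have [N' [Q' e']] := disc_multiple_swap fO.
have [P ->] := zY_of_disc_multiples Finf two_neq0 e e'.
by apply: subalg_gen_comp; apply: subalg_gen_zY.
Qed.
End Generating.

(** * Minimality *)

Section Minimality.
Variable F : fieldType.
Hypothesis two_neq0 : (2 : F) != 0.

Local Notation Y1 := (Ysym F 3 i0).
Local Notation Y2 := (Ysym F 3 i1).

Definition sym_of (s : seq F) : 'M[F]_3 := sym3 s`_0 s`_1 s`_2 s`_3 s`_4 s`_5.

Lemma sym_ofT s : (sym_of s)^T = sym_of s.
Proof. exact: sym3T. Qed.

Definition differ_only_at k (s s' : seq F) :=
  (forall j, j != k -> s`_j = s'`_j) /\ s`_k <> s'`_k.

(** The witnesses are integral and the two values differ by a power of 2 up to sign, so they work in
    every characteristic other than 2; squaring absorbs the sign. Missing entries of the lists are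
    zeros. *)
Lemma gens_separated k : (k < 10)%N -> exists a b a' b' : seq F,
  differ_only_at k (gens (sym_of a) (sym_of b)) (gens (sym_of a') (sym_of b')).
Proof.
have pow2 n (a b a' b' : seq F) :
    let s := gens (sym_of a) (sym_of b) in
    let s' := gens (sym_of a') (sym_of b') in
    (forall j, j != k -> s`_j = s'`_j) /\ (s`_k - s'`_k) ^+ 2 = 2 ^+ n ->
  exists a b a' b' : seq F,
    differ_only_at k (gens (sym_of a) (sym_of b)) (gens (sym_of a') (sym_of
      b')).
  move=> s s' [e1 e2]; exists a, b, a', b'; split=> // e; move/eqP: e2.
  by rewrite e subrr expr0n eq_sym (negPf (expf_neq0 n two_neq0)).
case: k pow2 => [|[|[|[|[|[|[|[|[|[|//]]]]]]]]]] pow2 _;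
  [ apply: (pow2 0 [:: 1] [::] [::] [::])
  | apply: (pow2 0 [:: 1; -1] [::] [::] [::])
  | apply: (pow2 4 [:: 0; 0; 0; 1; 1; 1] [::] [:: 0; 0; 0; -1; 1; 1] [::])
  | apply: (pow2 0 [::] [:: 1] [::] [::])
  | apply: (pow2 0 [::] [:: 1; -1] [::] [::])
  | apply: (pow2 4 [::] [:: 0; 0; 0; 1; 1; 1] [::] [:: 0; 0; 0; -1; 1; 1])
  | apply: (pow2 4 [:: 0; 0; 0; 0; 0; 1] [:: 0; 0; 0; 0; 0; 1]
             [:: 0; 0; 0; 0; 0; 1] [:: 0; 0; 0; 0; 0; -1])
  (* B is compared with -B: invariants of even degree in B agree, and tr B, det B, tr (AB) are
     zero. *)
  | apply: (pow2 4 [:: 1; -1] [:: 1; 1; -2; 0; 0; 1]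
             [:: 1; -1] [:: -1; -1; 2; 0; 0; -1])
  | apply: (pow2 4 [:: 1; 1; -2; 0; 0; 1] [:: 1; -1]
             [:: -1; -1; 2; 0; 0; -1] [:: 1; -1])
  (* Both triples (0, 3, 3) and (4, 1, 1) satisfy p^2 + q^2 + r^2 = 18, 2pqr + q^2 = 9 and q^2 =
     r^2, which fixes sigma_2(B), det B and tr (A B^2), while tr (A^2 B^2) is 19 or 35. *)
  | apply: (pow2 8 [:: 0; 1; -1] [:: 0; -1; 0; 0; 3; 3]
             [:: 0; 1; -1] [:: 0; -1; 0; 4; 1; 1]) ];
  rewrite /gens /sym_of /sym3 /= !mat3M !mxtrace_mat3 !det_mat3 !sigma2_mat3;
  split; try (by rewrite /=; ring);
  by case=> [|[|[|[|[|[|[|[|[|[|[|j]]]]]]]]]]] //= _; ring.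
Qed.

(** Minimality among generating sets follows as well, since a generating set separates. *)
Lemma gens_minimal (S' : set (Rplus F 3 2)) :
  S' `<` [set` gens Y1 Y2] -> ~ separating S'.
Proof.
move=> [S'S nSS'] [_ S'sep]; apply: nSS' => f /= /(nthP 0)[k k10 fE].
apply: contrapT => nf.
have [a [b [a' [b' [e1 e2]]]]] := gens_separated k10.
have HAB := Hplus_pair2 (sym_ofT a) (sym_ofT b).
have HAB' := Hplus_pair2 (sym_ofT a') (sym_ofT b').
have gE j c d : (j < 10)%N ->
    polyfun (gens Y1 Y2)`_j (pair2 (sym_of c) (sym_of d)) =
    (gens (sym_of c) (sym_of d))`_j.
  by move=> j10; rewrite -(polyfun_gens (Hplus_pair2 (sym_ofT c) (sym_ofT d)))
    (nth_map 0).
have [|h S'h] := S'sep _ _ HAB HAB'.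
  exists f; first by apply: (gens_RplusO two_neq0); rewrite -fE /= mem_nth.
  by rewrite -fE !gE.
have /(nthP 0)[j j10 hE] := S'S _ S'h.
have [jk|jk] := eqVneq j k; first by move=> _; apply: nf; rewrite -fE -jk hE.
by rewrite -hE !gE // e1.
Qed.
End Minimality.

Theorem theorem6p1 (F : fieldType) (Finf : infinite_set [set: F])
    (charF : 2%N \notin [pchar F]) :
  let Y1 := @Ysym F 3 2 (@Ordinal 2 0 isT) in
  let Y2 := @Ysym F 3 2 (@Ordinal 2 1 isT) in
  let S : set (Rplus F 3 2) :=
    [set` [:: \tr Y1; sigma 2 Y1; \det Y1;
              \tr Y2; sigma 2 Y2; \det Y2;
              \tr (Y1 *m Y2);
              \tr (Y1 *m Y1 *m Y2);
              \tr (Y1 *m Y2 *m Y2);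
              \tr (Y1 *m Y1 *m Y2 *m Y2)]] in
  minimal_for (@generating F 3 2) S /\ minimal_for (@separating F 3 2) S.
Proof.
move=> Y1 Y2 S.
have two_neq0 : (2 : F) != 0 by apply: contra charF => two0; rewrite inE.
have Sgen : generating S := gens_generating Finf two_neq0.
have Smin := gens_minimal two_neq0.
split; split=> [//|S' S'S]; last first.
- exact: Smin.
- exact: generating_separating.
- by move=> /generating_separating; apply: Smin.
Qed.
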